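(* Let $X$ be a random vector in $\mathbb{R}_+^d$. Then there exists a sequence of random vectors $\{X_n\}_{n\in\mathbb{N}}$ in $\mathbb{R}_+^d$, where each $X_n$ has a multivariate phase-type (mPH) distribution, such that $X_n\to X$ in distribution as $n\to\infty$. In particular, the $X_n$ may be taken to be distributed as finite mixtures of $d$-dimensional random vectors with independent Erlang components.
   Context: Notation: $\mathbb{R}_+=(0,\infty)$. An Erlang distribution is a Gamma distribution with shape parameter $k\in\{1,2,\dots\}$ and rate $\lambda>0$. Convergence in distribution is pointwise convergence of multivariate cumulative distribution functions at continuity points of the limit. mPH class. Let $\boldsymbol{\pi}=(\pi_1,\dots,\pi_p)$ be a probability row vector and let $\boldsymbol{T}_1,\dots,\boldsymbol{T}_d$ be real $p\times p$ sub-intensity matrices (nonnegative off-diagonal entries, strictly negative diagonal entries, nonpositive row sums) for which all states $1,\dots,p$ are transient (equivalently, each $\boldsymbol{T}_i$ is invertible). Let $\boldsymbol{e}$ be the column vector of ones in $\mathbb{R}^p$ and $\boldsymbol{t}_i=-\boldsymbol{T}_i\boldsymbol{e}$. For $i=1,\dots,d$ let $(J^{(i)}_t)_{t\ge 0}$ be a time-homogeneous Markov jump process on $\{1,\dots,p,p+1\}$ with $p+1$ absorbing, with transition intensities between the states $1,\dots,p$ given by $\boldsymbol{T}_i$ and intensities of jumping to $p+1$ given by $\boldsymbol{t}_i$. Assume that all the processes start in the same state, $J_0^{(1)}=\dots=J_0^{(d)}=:J_0$ with $\mathbb{P}(J_0=j)=\pi_j$ for $j=1,\dots,p$, and that the $d$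 processes are conditionally independent given $J_0$. Put $X_i=\inf\{t>0: J^{(i)}_t=p+1\}$. Then $X=(X_1,\dots,X_d)$ is said to have a multivariate phase-type (mPH) distribution. The dimension $p\ge 1$ is arbitrary (and may depend on $n$ in the approximating sequence). *)

(* Defs.v *)
From HB Require Import structures.
From mathcomp Require Import all_boot all_order all_algebra.
From mathcomp Require Import all_classical all_reals all_analysis.

Set Implicit Arguments.
Unset Strict Implicit.
Unset Printing Implicit Defensive.

Import Order.TTheory GRing.Theory Num.Theory.
Import numFieldNormedType.Exports.

Local Open Scope classical_set_scope.
Local Open Scope ring_scope.

(** A random vector is a random variable with values in [d.-tuple R], which
    carries the product of the Borel sigma-algebras; its law is the library's
    [distribution P X], a measure on [d.-tuple R]. *)

Section convergence_in_distribution.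
Context (R : realType) (d : nat).

(* The argument is a row vector because [d.-tuple R] has no topology in the
   library. *)
Definition joint_cdf (mu : set (d.-tuple R) -> \bar R) (x : 'rV[R]_d) : \bar R :=
  mu [set y | forall i, tnth y i <= x ord0 i].

Definition cvg_in_distribution (mu_ : nat -> set (d.-tuple R) -> \bar R)
    (mu : set (d.-tuple R) -> \bar R) : Prop :=
  forall x : 'rV[R]_d, {for x, continuous (joint_cdf mu)} ->
    joint_cdf (mu_ n) x @[n --> \oo] --> joint_cdf mu x.

End convergence_in_distribution.

Section erlang_mixtures.
Context (R : realType).

Definition erlang_pdf (k : nat) (rate : R) : R -> R :=
  (fun x => rate ^+ k * x ^+ k.-1 * expR (- rate * x) / (k.-1)`!%:R)
    \_ `[0, +oo[.

Definition erlang_prob (k : nat) (rate : R) (V : set R) : \bar R :=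
  (\int[lebesgue_measure]_(x in V) (erlang_pdf k rate x)%:E)%E.

(* Law of a random vector with independent components, the i-th one being
   Erlang with shape [k i] and rate [rate i]. *)
Definition independent_erlang (d : nat) (k : 'I_d -> nat) (rate : 'I_d -> R)
    (nu : probability (d.-tuple R) R) : Prop :=
  [/\ forall i, (0 < k i)%N, forall i, 0 < rate i &
      forall B : 'I_d -> set R, (forall i, measurable (B i)) ->
        nu [set y | forall i, B i (tnth y i)] =
        (\prod_(i < d) erlang_prob (k i) (rate i) (B i))%E].

Definition erlang_mixture (d : nat) (mu : set (d.-tuple R) -> \bar R) : Prop :=
  exists (M : nat) (w : 'I_M -> R) (k : 'I_M -> 'I_d -> nat)
    (rate : 'I_M -> 'I_d -> R) (nu : 'I_M -> probability (d.-tuple R) R),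
  [/\ forall m, 0 <= w m,
      \sum_m w m = 1,
      forall m, independent_erlang (k m) (rate m) (nu m) &
      forall A : set (d.-tuple R), measurable A ->
        mu A = (\sum_m (w m)%:E * nu m A)%E].

End erlang_mixtures.

Section markov_jump_processes.
Context (R : realType) (S : finType).

Definition transition_function (Q : S -> S -> R) (p : R -> S -> S -> R) : Prop :=
  [/\ forall (t : R) s u, 0 <= t -> 0 <= p t s u,
      forall (t : R) s, 0 <= t -> \sum_u p t s u = 1,
      forall s u, p 0 s u = (s == u)%:R,
      forall (t t' : R) s u, 0 <= t -> 0 <= t' ->
        p (t + t') s u = \sum_v p t s v * p t' v u &
      forall s u, (p h s u - (s == u)%:R) / h @[h --> 0^'+] --> Q s u].

Context (disp : measure_display) (Omega : measurableType disp).
Context (P : probability Omega R).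

(* Processes are indexed by all of [R], but only times [0 <= t] matter. *)
Definition jump_path (x : R -> S) : Prop :=
  (forall t : R, 0 <= t -> \forall u \near t^'+, x u = x t) /\
  (forall t : R, 0 < t -> exists s, \forall u \near t^'-, x u = s).

(* The last clause is
     P(J_(t_(n+1)) = s_(n+1) | J_(t_0) = s_0, ..., J_(t_n) = s_n)
       = p_(t_(n+1) - t_n)(s_n, s_(n+1)),
   multiplied out so that null conditioning events need no special case. *)
Definition markov_jump_process (Q : S -> S -> R) (J : R -> Omega -> S) : Prop :=
  [/\ forall (t : R) s, 0 <= t -> measurable [set w | J t w = s],
      forall w, jump_path (J ^~ w) &
      exists2 p, transition_function Q p &
        forall (n : nat) (t : nat -> R) (s : nat -> S),
          0 <= t 0%N -> (forall k, t k < t k.+1) ->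
          P [set w | forall k, (k <= n.+1)%N -> J (t k) w = s k] =
          (P [set w | forall k, (k <= n)%N -> J (t k) w = s k] *
           (p (t n.+1 - t n) (s n) (s n.+1))%:E)%E].

Definition sigma_of_process (J : R -> Omega -> S) : set (set Omega) :=
  <<s [set A | exists (t : R) s, 0 <= t /\ A = [set w | J t w = s]] >>.

Definition cond_prob (A B : set Omega) : R := fine (P (A `&` B)) / fine (P B).

Definition cond_independent (d : nat) (J0 : Omega -> S)
    (J : 'I_d -> R -> Omega -> S) : Prop :=
  forall s, P [set w | J0 w = s] != 0%E ->
  forall A : 'I_d -> set Omega, (forall i, sigma_of_process (J i) (A i)) ->
    cond_prob [set w | forall i, A i w] [set w | J0 w = s] =
    \prod_(i < d) cond_prob (A i) [set w | J0 w = s].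

End markov_jump_processes.

Section multivariate_phase_type.
Context (R : realType).

Definition probability_row (p : nat) (pi : 'rV[R]_p) : Prop :=
  (forall j, 0 <= pi ord0 j) /\ \sum_j pi ord0 j = 1.

(* [T \in unitmx] expresses that all the states are transient. *)
Definition transient_sub_intensity (p : nat) (T : 'M[R]_p) : Prop :=
  [/\ forall j k, j != k -> 0 <= T j k,
      forall j, T j j < 0,
      forall j, \sum_k T j k <= 0 &
      T \in unitmx].

Definition exit_rates (p : nat) (T : 'M[R]_p) : 'cV[R]_p :=
  - (T *m const_mx 1).

(* [Some j], [j : 'I_p], are the transient states and [None] is the absorbing
   state p + 1. *)
Definition intensity (p : nat) (T : 'M[R]_p) (s u : option 'I_p) : R :=
  match s, u with
  | Some j, Some k => T j k
  | Some j, None => exit_rates T j ord0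
  | None, _ => 0
  end.

Definition absorption_time (S : Type) (x : R -> option S) : \bar R :=
  ereal_inf [set t%:E | t in [set t : R | 0 < t /\ x t = None]].

Section construction.
Context (disp : measure_display) (Omega : measurableType disp).
Context (P : probability Omega R) (d p : nat).

Definition mPH_processes (pi : 'rV[R]_p) (T : 'I_d -> 'M[R]_p)
    (J : 'I_d -> R -> Omega -> option 'I_p) : Prop :=
  (forall i, markov_jump_process P (intensity (T i)) (J i)) /\
  exists J0 : Omega -> option 'I_p,
    [/\ forall i w, J i 0 w = J0 w,
        forall j, P [set w | J0 w = Some j] = (pi ord0 j)%:E &
        cond_independent P J0 J].

End construction.

(* The absorption times may be infinite on a null set, hence the almost sure
   equality. *)
Definition mPH (d : nat) (mu : set (d.-tuple R) -> \bar R) : Prop :=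
  exists (p : nat) (pi : 'rV[R]_p) (T : 'I_d -> 'M[R]_p)
    (disp : measure_display) (Omega : measurableType disp)
    (P : probability Omega R) (J : 'I_d -> R -> Omega -> option 'I_p)
    (Y : {RV P >-> d.-tuple R}),
  [/\ probability_row pi,
      forall i, transient_sub_intensity (T i),
      mPH_processes P pi T J,
      {ae P, forall w, forall i,
        (tnth (Y w) i)%:E = absorption_time (J i ^~ w)} &
      forall A : set (d.-tuple R), measurable A -> mu A = distribution P Y A].

End multivariate_phase_type.

(* Main.v *)
Require Import Defs.
From HB Require Import structures.
From mathcomp Require Import all_boot all_order all_algebra.
From mathcomp Require Import all_classical all_reals all_analysis.
From mathcomp Require Import measurable_realfun ring lra.

Set Implicit Arguments.
Unset Strict Implicit.
Unset Printing Implicit Defensive.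

Import Order.TTheory GRing.Theory Num.Theory.
Import numFieldNormedType.Exports.

Local Open Scope classical_set_scope.
Local Open Scope ring_scope.

(** Each coordinate of the limit is truncated and rounded up to a multiple of 1/N,
    and each grid point is replaced by independent Erlang variables of common
    rate N^2 whose means are its coordinates; by Chebyshev's inequality their
    deviation is negligible.

    Such a mixture is an mPH law because all sojourn rates are equal: let
    [f_i] be a strictly decreasing partial map on the states and put
    [J^i_t = f_i^(N^i_t) (J_0)] for independent Poisson processes [N^i].
    Absorption happens at the time of the k-th jump, k being the number of
    iterations of [f_i] leading from [J_0] to the absorbing state, and this time
    is Erlang.  The common initial state selects the shapes of all coordinates.
    Taking for [J_0] the grid cell of the given vector realizes the approximation
    and its limit on the same space.

    The Markov property is proved by first-step analysis on the clocks
    (interarrival times): if the first clock rings before the first observation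
    time, the remaining clocks start afresh from [f s]; if not, the exponential
    law has no memory. *)

(** * Paths driven by clocks *)

(** One computation carries the proof: the joint law of a clock path at finitely many times. The
    Markov property, the Chapman-Kolmogorov equation, the nonnegativity of the transition
    probabilities and the Erlang law of a sum of clocks are all read off from it. Finite lists of
    clocks stand for the Poisson processes, since a decreasing map on [p] states is absorbed after
    at most [p] jumps.

    The obstacle is that the coordinates ask for different shapes although all chains share one
    state space and one initial state. Hence every grid cell is an initial state of its own, from
    which the map of each coordinate enters a common chain at the height which that coordinate
    requires.

    Rate [N] would already put the Erlang means on the grid of step [1/N], but for means near [N] it
    would leave a variance of order 1. At rate [N ^ 2] the shapes grow to order [N ^ 3] and the
    variance falls to order [1/N]. *)

Section paths.
Context (R : realType) (S : finType) (f : S -> S).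

(** The entries of [es] are interarrival times. When they are used up the path stays where it is;
    the lists will be long enough for the path to be absorbed by then. *)
Fixpoint clock_path (es : seq R) (s : S) (t : R) : S :=
  if es is e :: es' then if t < e then s else clock_path es' (f s) (t - e)
  else s.

Lemma clock_path_0 es s : all (> 0) es -> clock_path es s 0 = s.
Proof. by case: es => //= e es /andP[-> _]. Qed.

Lemma near_shiftr (e t : R) (A : set R) :
  (\forall u \near t - e, A u) -> \forall u \near t, A (u - e).
Proof.
have ct : (fun u : R => u - e) @ t --> t - e by apply: cvgB => //; exact: cvg_cst.
exact: (ct A).
Qed.

(** The strict test [t < e] puts the path in its new state at the ring itself, which makes it
    right-continuous. *)
Lemma clock_path_right es s (t : R) :
  \forall u \near t^'+, clock_path es s u = clock_path es s t.
Proof.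
elim: es s t => [|e es IH] s t /=; first exact: nearW.
have [te|et] := ltP t e.
  by apply: filterS (nbhs_right_lt te) => u ->.
have := IH (f s) (t - e); rewrite !near_withinE => /near_shiftr.
apply: filterS => u Hu tu.
by rewrite ifF ?Hu ?ltrD2r//; apply/negbTE; rewrite -leNgt (le_trans et)// ltW.
Qed.

Lemma clock_path_left es s (t : R) :
  exists v, \forall u \near t^'-, clock_path es s u = v.
Proof.
elim: es s t => [|e es IH] s t /=; first by exists s; exact: nearW.
have [te|et] := leP t e.
  exists s; apply: filterS (nbhs_left_lt t) => u ut.
  by rewrite (lt_le_trans ut te).
have [v Hv] := IH (f s) (t - e); exists v.
move: Hv; rewrite near_withinE => /near_shiftr Hv.
have {}Hv : \forall u \near t^'-, u - e < t - e ->
    clock_path es (f s) (u - e) = v by exact: cvg_within Hv.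
apply: filterS3 Hv (nbhs_left_ge et) (nbhs_left_lt t) => u Hu eu ut.
by rewrite ltNge eu/= Hu// ltrD2r.
Qed.

Lemma jump_path_clock_path es s : jump_path (clock_path es s).
Proof. by split=> t _; [exact: clock_path_right|exact: clock_path_left]. Qed.

(* [L] lists pairs (time increment, state at the end of the increment),
   counted from time [b]. *)
Fixpoint visits (x : R -> S) (b : R) (L : seq (R * S)) : Prop :=
  if L is (h, u) :: L' then x (b + h) = u /\ visits x (b + h) L' else True.

Lemma visits_cons x b h u L :
  visits x b ((h, u) :: L) = (x (b + h) = u /\ visits x (b + h) L).
Proof. by []. Qed.

Fixpoint visit_prob (p : R -> S -> S -> R) (s : S) (L : seq (R * S)) : R :=
  if L is (h, u) :: L' then p h s u * visit_prob p u L' else 1.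

Fixpoint schedule (n : nat) (b : R) (t : nat -> R) (s : nat -> S)
    : seq (R * S) :=
  if n is n'.+1 then
    (t 0%N - b, s 0%N) :: schedule n' (t 0%N) (fun k => t k.+1)
      (fun k => s k.+1)
  else [::].

Lemma visits_schedule x n b t s :
  visits x b (schedule n b t s) <-> (forall k, (k < n)%N -> x (t k) = s k).
Proof.
elim: n b t s => [|n IH] b t s /=; first by split.
rewrite addrC subrK IH; split=> [[x0 xS] [|k] //|H].
  by rewrite ltnS => /xS.
by split; [exact: H|move=> k kn; exact: H].
Qed.

(** A schedule is built from its front, whereas the Markov property appends an observation at the
    end. *)
Lemma visit_prob_schedule p n b t s u :
  visit_prob p u (schedule n.+2 b t s) =
  visit_prob p u (schedule n.+1 b t s) *
  p (t n.+1 - t n) (s n) (s n.+1).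
Proof.
elim: n b t s u => [|n IH] b t s u; first by rewrite /= !mulr1.
move: (IH (t 0%N) (fun k => t k.+1) (fun k => s k.+1) (s 0%N)).
by rewrite /= => ->; rewrite mulrA.
Qed.

Lemma schedule_ge0 n b t s : b <= t 0%N -> (forall k, t k < t k.+1) ->
  all (fun hu => 0 <= hu.1) (schedule n b t s).
Proof.
elim: n b t s => //= n IH b t s bt tt.
by rewrite subr_ge0 bt/= IH// ltW.
Qed.

(** Nonnegative increments look only at the path from the base time on. This allows a restart both
    after a clock has rung and while one is still running. *)
Lemma visits_eq x y b c L : all (fun hu => 0 <= hu.1) L ->
  (forall t, 0 <= t -> x (b + t) = y (c + t)) -> visits x b L <-> visits y c L.
Proof.
elim: L b c => //= -[h u] L IH b c /= /andP[h0 L0] xy.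
rewrite xy// (IH (b + h) (c + h))// => t t0.
by rewrite -!addrA xy// addr_ge0.
Qed.

Section absorption.
Context (z : S).
Hypothesis fz : f z = z.

Lemma iter_absorbed n : iter n f z = z.
Proof. by elim: n => //= n ->. Qed.

Lemma clock_path_z es t : clock_path es z t = z.
Proof. by elim: es t => //= e es IH t; rewrite fz IH; case: ifP. Qed.

(** Exactly [k] rings lead from [s] to [z], and [fz] keeps the path there. The equivalence serves
    twice: to get the law of a sum of clocks from transition probabilities, and to identify
    absorption times. *)
Lemma clock_path_absorbed k es s t : all (> 0) es -> 0 <= t ->
  (k <= size es)%N -> iter k f s = z ->
  (forall j, (j < k)%N -> iter j f s != z) ->
  clock_path es s t = z <-> \sum_(e <- take k es) e <= t.
Proof.
elim: k es s t => [|k IH] [|e es] s t //= es0 t0 kes; rewrite ?big_nil ?t0.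
- by move=> ->.
- by move=> -> _; split=> // _; rewrite fz clock_path_z; case: ifP.
case/andP: es0 => e0 es0; rewrite -iterS iterSr => ks Hk.
rewrite big_cons; case: ltP => te.
  split=> [sz|]; first by have := Hk 0%N isT; rewrite /= sz eqxx.
  suff: 0 <= \sum_(e0 <- take k es) e0.
    by move=> ? ?; exfalso; lra.
  rewrite big_seq sumr_ge0// => x /mem_take xes.
  exact/ltW/(allP es0).
rewrite IH ?subr_ge0//; last first.
  by move=> j jk; rewrite -iterSr; exact: Hk.
by rewrite lerBrDl.
Qed.

End absorption.

End paths.

(** * Transition probabilities *)

Section poisson_transition.
Context (R : realType) (S : finType) (f : S -> S) (z : S) (N : nat) (lam : R).
Hypothesis fN : forall s, iter N f s = z.
Hypothesis fz : f z = z.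

Definition pois (n : nat) (t : R) : R :=
  expR (- (lam * t)) * (lam * t) ^+ n / n`!%:R.

(* Law at time [t] of [iter N_t f s], [N_t] Poisson: all the terms [n >= N] are
   collected on the absorbing state [z], which receives the remaining mass. *)
Definition poisson_trans (t : R) (s u : S) : R :=
  \sum_(n < N) pois n t * ((iter n f s == u)%:R - (z == u)%:R) + (z == u)%:R.

Lemma pois_0 n : pois n 0 = (n == 0%N)%:R.
Proof.
rewrite /pois mulr0 oppr0 expR0 mul1r expr0n.
by case: n => [|n]; rewrite ?fact0 ?divr1// mul0r.
Qed.

Lemma is_derive_pois0 (t : R) :
  is_derive t (1 : R) (pois 0) (- (lam * pois 0 t)).
Proof.
have -> : pois 0 = expR \o (- (lam \*: (id : R -> R))).
  by apply/funext => x; rewrite /pois expr0 mulr1 divr1.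
apply: is_derive_eq.
by rewrite /GRing.scale/= mulr1 mulrN mulrC.
Qed.

Lemma is_derive_poisS n (t : R) :
  is_derive t (1 : R) (pois n.+1) (lam * (pois n t - pois n.+1 t)).
Proof.
have E : pois n.+1 = (n.+1)`!%:R^-1 \*: ((expR \o (- (lam \*: (id : R -> R)))) *
    (lam \*: (id : R -> R)) ^+ n.+1).
  by apply/funext => x; rewrite /pois !fctE/= mulrC.
rewrite [X in is_derive _ _ X _]E.
apply: is_derive_eq.
have n0 : n`!%:R != 0 :> R by rewrite pnatr_eq0 -lt0n fact_gt0.
have n1 : n.+1%:R != 0 :> R by rewrite pnatr_eq0.
rewrite /pois factS natrM !fctE /= !exprS -mulr_natr /GRing.scale /=.
move: (n`!%:R) (n.+1%:R) n0 n1 ((lam * t) ^+ n) (expR _) => a b a0 b0 x y.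
by field; rewrite a0 b0.
Qed.

Lemma poisson_trans_0 s u : poisson_trans 0 s u = (s == u)%:R.
Proof.
rewrite /poisson_trans; case: N fN => [|n] H.
  by rewrite big_ord0 add0r -(H s).
rewrite big_ord_recl pois_0 mul1r/= big1 ?addr0 ?subrK// => i _.
by rewrite pois_0 mul0r.
Qed.

(** Kolmogorov's backward equation. The derivative of a Poisson weight is [lam] times the difference
    between the preceding weight and itself; shifting the index in the sum of the preceding weights
    yields the sum started from [f s]. *)
Lemma is_derive_poisson_trans (t : R) s u :
  is_derive t (1 : R) (fun x => poisson_trans x s u)
    (lam * (poisson_trans t (f s) u - poisson_trans t s u)).
Proof.
pose a n := (iter n f s == u)%:R - (z == u)%:R : R.
pose q n := if n is n'.+1 then pois n' t else 0.
pose D n := lam * (q n - pois n t).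
have dpois n : is_derive t (1 : R) (pois n) (D n).
  case: n => [|n]; last exact: is_derive_poisS.
  by apply: is_derive_eq (is_derive_pois0 t) _; rewrite /D /q; ring.
have -> : (fun x => poisson_trans x s u) =
    (\sum_(n < N) (a n \*: (pois n : R -> R))) + cst ((z == u)%:R).
  apply/funext => x; rewrite /poisson_trans [RHS]/GRing.add/=; congr (_ + _).
  rewrite fct_sumE; apply: eq_bigr => i _.
  by rewrite mulrC.
apply: is_derive_eq.
rewrite addr0 /poisson_trans /a /D /GRing.scale/=.
have aN : iter N f s = z by [].
have -> : \sum_(n < N) pois n t * ((iter n f (f s) == u)%:R - (z == u)%:R) =
    \sum_(n < N) q n * ((iter n f s == u)%:R - (z == u)%:R) :> R.
  case: N aN => [|m] am; first by rewrite !big_ord0.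
  (* The shift loses nothing at either end: the first weight on the right is [q 0 = 0], and in the
     last term on the left [N] steps from [s] have reached [z]. *)
  rewrite [RHS]big_ord_recl/= mul0r add0r big_ord_recr/= -iterSr am subrr mulr0 addr0.
  by apply: eq_bigr => i _; rewrite -iterSr.
rewrite opprD addrACA subrr addr0 -sumrB mulr_sumr.
by apply: eq_bigr => i _; ring.
Qed.

Lemma poisson_trans_z t u : poisson_trans t z u = (z == u)%:R.
Proof.
rewrite /poisson_trans big1 ?add0r// => i _.
by rewrite iter_absorbed// subrr mulr0.
Qed.

End poisson_transition.

(** * The exponential law *)

(** The closed left half-lines are stable under intersection, generate the Borel sets and contain a
    sequence of finite measure covering the line. Measures rather than probabilities are allowed
    because restricted and rescaled laws will be compared. *)
Lemma finite_measure_cdf_unique (R : realType) (m1 m2 : {measure set (measurableTypeR R) -> \bar R}) :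
  (forall a : R, m1 `]-oo, a]%classic = m2 `]-oo, a]%classic) ->
  (forall a : R, (m1 `]-oo, a]%classic < +oo)%E) ->
  forall A, measurable A -> m1 A = m2 A.
Proof.
move=> m12 m1oo A mA.
pose G : set (set (measurableTypeR R)) := [set A | exists x : R, A = `]-oo, x]%classic].
apply: (@g_sigma_algebra_measure_unique _ _ _ G _ (fun n => `]-oo, n%:R]%classic)).
- by move=> _ [x ->]; exact: measurable_itv.
- by move=> i; exists i%:R.
- rewrite -subTset => x _; exists (Num.truncn x).+1 => //=.
  by rewrite in_itv/= ltW// truncnS_gt.
- move=> _ _ [x ->] [y ->]; exists (Num.min x y).
  by apply/seteqP; split=> r /=; rewrite !in_itv/= le_min => /andP.
- by move=> _ [x ->].
- by move=> k.
- have : <<s @RGenOInfty.G R >> A by rewrite -[<<s _ >> _]/((RGenOInfty.G (R := R)).-sigma.-measurable A) -RGenOInfty.measurableE.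
  apply: smallest_sub; first exact: smallest_sigma_algebra.
  move=> _ [x ->]; rewrite -setCitvl.
  have : G.-sigma.-measurable `]-oo, x]%classic by apply: sub_sigma_algebra; exists x.
  by move=> /measurableC.
Qed.

Section exponential_law.
Context (R : realType) (lam : R) (lam0 : 0 < lam).

Lemma exponential_law : exists P : probability (measurableTypeR R) R,
  forall A, P A = exponential_prob lam A.
Proof.
by exists (exponential_distribution_exponential_prob__canonical__probability_measure_Probability lam0).
Qed.

Context (P : probability (measurableTypeR R) R) (PE : forall A, P A = exponential_prob lam A).
Local Notation mu := (@lebesgue_measure R).

Lemma exponential_law_dominates : P `<< mu.
Proof.
apply/null_content_dominatesP => A mA muA0; rewrite PE.
rewrite /exponential_prob null_set_integral//.
by apply: measurable_funTS; apply/measurable_EFinP; exact: measurable_exponential_pdf.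
Qed.

(** The Radon-Nikodym derivative of [P] agrees almost everywhere with [exponential_pdf], since both
    have the same integral over every measurable set. *)
Lemma integral_exponential_law (D : set (measurableTypeR R)) (f : measurableTypeR R -> \bar R) : measurable D ->
  P.-integrable D f ->
  (\int[P]_(x in D) f x = \int[mu]_(x in D) (f x * (exponential_pdf lam x)%:E))%E.
Proof.
move=> mD intf.
have mf := measurable_int _ intf.
rewrite -(Radon_Nikodym_change_of_variables exponential_law_dominates)//=.
apply: ae_eq_integral => //.
- apply: emeasurable_funM => //; apply: (measurable_int mu).
  apply: (integrableS _ _ (@subsetT _ _)) => //=.
  by apply: Radon_Nikodym_integrable; exact: exponential_law_dominates.
- apply: emeasurable_funM => //=; apply/measurableT_comp => //=.
  by apply/measurable_funTS; exact: measurable_exponential_pdf.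
- apply: ae_eqe_mul2l => /=.
  rewrite Radon_NikodymE//=; first exact: exponential_law_dominates.
  move=> dom.
  case: cid => /= h [h1 h2 h3].
  apply: integral_ae_eq => //=.
  + exact: integrableS h2.
  + by apply: measurable_funTS; apply/measurable_EFinP; exact: measurable_exponential_pdf.
  + by move=> E E01 mE; rewrite -h3//= PE.
Qed.

Lemma exponential_law_le0 : P `]-oo, 0]%classic = 0%E.
Proof.
rewrite PE /exponential_prob.
have -> : (\int[mu]_(x in `]-oo, 0%R]) (exponential_pdf lam x)%:E =
    \int[mu]_(x in `]-oo, 0%R[) (exponential_pdf lam x)%:E)%E.
  apply/esym/integral_itv_bndo_bndc => //.
  by apply: measurable_funTS; apply/measurable_EFinP; exact: measurable_exponential_pdf.
rewrite integral0_eq// => x /=; rewrite in_itv/= => x0.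
by rewrite lt0_exponential_pdf.
Qed.

Lemma exponential_law_itv (a : R) : 0 <= a ->
  P `]-oo, a]%classic = (1 - expR (- lam * a))%:E.
Proof.
rewrite le_eqVlt => /predU1P[<-|a0].
  by rewrite exponential_law_le0 mulr0 expR0 subrr.
have -> : `]-oo, a]%classic = `]-oo, 0[ `|` `[0, a] :> set R.
  by rewrite -itv_bndbnd_setU// bnd_simp ltW.
rewrite measureU//; last first.
  apply/seteqP; split => // x /=; rewrite !in_itv/= => -[x0 /andP[x1 _]].
  by move: x0; rewrite ltNge x1.
rewrite [X in (X + _)%E](_ : _ = 0%E) ?add0e; last first.
  apply/eqP; rewrite eq_le measure_ge0 andbT -exponential_law_le0.
  by rewrite le_measure ?inE// => x /=; rewrite !in_itv/=; exact: ltW.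
exact: (etrans (PE _) (exponential_prob_itv0c _ a0)).
Qed.

Lemma exponential_law_oc (a b : R) : 0 <= a -> a <= b ->
  P `]a, b]%classic = (expR (- lam * a) - expR (- lam * b))%:E.
Proof.
move=> a0 ab.
have -> : `]a, b]%classic = `]-oo, b] `\` `]-oo, a] :> set R.
  apply/seteqP; split => x /=; rewrite !in_itv/=.
    by move=> /andP[ax ->]; split=> //; apply/negP; rewrite -ltNge.
  by move=> [-> /negP]; rewrite -ltNge => ->.
rewrite measureD//=; last by rewrite -ge0_fin_numE// fin_num_measure.
rewrite setIidr; last by move=> x /=; rewrite !in_itv/= => /le_trans; apply.
rewrite !exponential_law_itv ?(le_trans a0)// -EFinB; congr (_%:E); ring.
Qed.

(** On the positive half-line, the image of the law under the shift by [d] is [expR (- lam * d)]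
    times the law itself. It suffices to compare these finite measures on half-lines. *)
Lemma exponential_memoryless (d : R) (g : measurableTypeR R -> \bar R) : 0 <= d ->
  measurable_fun setT g -> (forall x, 0 <= g x)%E ->
  (\int[P]_(x in `]d, +oo[) g (x - d)%R =
   (expR (- lam * d))%:E * \int[P]_(x in `]0%R, +oo[) g x)%E.
Proof.
move=> d0 mg g0.
pose phi (x : measurableTypeR R) : measurableTypeR R := x - d.
have mphi : measurable_fun setT phi by exact: measurable_funB.
have -> : `]d, +oo[%classic = phi @^-1` `]0, +oo[.
  by apply/seteqP; split => x /=; rewrite !in_itv/= !andbT /phi subr_gt0.
rewrite -(@ge0_integral_pushforward _ _ _ _ _ phi mphi P `]0%R, +oo[%classic g)//; last first.
  exact: measurable_funTS.
have e0 : 0 <= expR (- lam * d) by exact: expR_ge0.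
pose k : {nonneg R} := NngNum e0.
have -> : (expR (- lam * d))%:E = (k%:num)%:E by [].
rewrite -ge0_integral_mscale//; last exact: measurable_funTS.
have mD : measurable (`]0, +oo[%classic : set (measurableTypeR R)) by [].
apply: eq_measure_integral => A mA AD.
have AE : A = A `&` `]0, +oo[ by rewrite setIidl.
rewrite AE.
apply: (@finite_measure_cdf_unique R (mrestr (pushforward P phi) mD)
  (mscale k (mrestr P mD))) => // a.
- change (P (phi @^-1` (`]-oo, a]%classic `&` `]0%R, +oo[%classic)) =
    ((k%:num)%:E * P (`]-oo, a]%classic `&` `]0%R, +oo[%classic))%E).
  have [a0|a0] := leP a 0.
    have -> : `]-oo, a] `&` `]0, +oo[ = set0 :> set (measurableTypeR R).
      apply/seteqP; split => // x /=; rewrite !in_itv/= andbT => -[xa x0].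
      by have := le_lt_trans (le_trans xa a0) x0; rewrite ltxx.
    by rewrite preimage_set0 !measure0 mule0.
  have -> : `]-oo, a] `&` `]0, +oo[ = `]0, a]%classic :> set (measurableTypeR R).
    by apply/seteqP; split => x /=; rewrite !in_itv/= andbT andbC => /andP.
  have -> : phi @^-1` `]0, a] = `]d, (a + d)]%classic.
    by apply/seteqP; split => x /=; rewrite !in_itv/= subr_gt0 lerBlDr.
  rewrite !exponential_law_oc ?lerDr ?(ltW a0)// -EFinM mulr0 expR0 mulrBr mulr1.
  by rewrite -expRD; congr (_ - expR _)%:E; ring.
- change (P (phi @^-1` (`]-oo, a]%classic `&` `]0%R, +oo[%classic)) < +oo)%E.
  rewrite -ge0_fin_numE//; apply: fin_num_measure => //.
  by rewrite -[X in measurable X]setTI; apply: mphi => //; exact: measurableI.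
Qed.
End exponential_law.

(** * The Markov property *)

Section renewal.
Context (R : realType) (S : finType) (f : S -> S) (z : S) (N : nat) (lam : R).
Hypothesis fN : forall s, iter N f s = z.
Local Notation p := (poisson_trans f z N lam).
Local Notation mu := (@lebesgue_measure R).

(* By the backward equation [p' = lam (p (f s) - p s)], the renewal integrand is
   the derivative of [- e^(- lam y) p_(d - y)(s, u)]. *)
Lemma is_derive_renewal (d c : R) s u (x : R) :
  is_derive x (1 : R) (fun y => - (c * (expR (- lam * y) * p (d - y) s u)))
    (p (d - x) (f s) u * c * (lam * expR (- lam * x))).
Proof.
have dp := is_derive_poisson_trans lam fN (d - x) s u.
have dl : is_derive x (1 : R) (fun y : R => d - y) (- 1).
  have -> : (fun y : R => d - y) = cst d - id by apply/funext.
  by apply: is_derive_eq; rewrite sub0r.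
have d1 := @is_derive1_comp R (fun y => p y s u) (fun y : R => d - y) x _ _ dp dl.
have -> : (fun y => - (c * (expR (- lam * y) * p (d - y) s u))) =
   - (c \*: ((expR \o ((- lam) \*: (id : R -> R))) *
       ((fun y => p y s u) \o (fun y : R => d - y)))) :> (R -> R).
  by apply/funext.
apply: is_derive_eq; rewrite /GRing.scale/=; ring.
Qed.

Lemma continuous_is_derive (F dF : R -> R) :
  (forall x, is_derive x (1 : R) F (dF x)) -> continuous F.
Proof.
move=> H x; apply: differentiable_continuous; apply/derivable1_diffP.
by have [] := H x.
Qed.

(** The boundary terms of the primitive give [p d s u] at 0 and, at [d], the part
    [expR (- lam * d) * (s == u)%:R] where no clock has rung. The factor [c] stands for the later
    visits, whose probability does not depend on the first ring. *)
Lemma integral_renewal (d c : R) s u : 0 <= d ->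
  (\int[mu]_(x in `[0%R, d]) ((p (d - x) (f s) u * c)%:E * (exponential_pdf lam x)%:E)
   = ((p d s u - expR (- lam * d) * (s == u)%:R) * c)%:E)%E.
Proof.
rewrite le_eqVlt => /predU1P[<-|d0].
  rewrite set_itv1 integral_set1 mulr0 expR0 mul1r poisson_trans_0//.
  by rewrite subrr mul0r.
pose F y := - (c * (expR (- lam * y) * p (d - y) s u)).
pose G x := p (d - x) (f s) u * c * (lam * expR (- lam * x)).
transitivity (\int[mu]_(x in `[0%R, d]) (G x)%:E)%E.
  apply: eq_integral => x; rewrite inE/= in_itv/= => /andP[x0 _].
  by rewrite -EFinM exponential_pdfE.
have dF x : is_derive x (1 : R) F (G x) := is_derive_renewal d c s u x.
have cF : continuous F := continuous_is_derive dF.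
rewrite (@continuous_FTC2 _ _ F)//.
- rewrite /F -EFinB subrr subr0 mulr0 expR0 poisson_trans_0//; congr EFin; ring.
- apply: continuous_subspaceT => x.
  apply: cvgM; first apply: cvgM; [|exact: cvg_cst|].
    apply: (@continuous_comp _ _ _ (fun x => d - x) (fun y => p y (f s) u)).
      by apply: cvgB; [exact: cvg_cst|exact: cvg_id].
    exact: (continuous_is_derive (fun y => is_derive_poisson_trans lam fN y (f s) u)).
  apply: cvgM; first exact: cvg_cst.
  apply: continuous_comp; last exact: continuous_expR.
  by apply: cvgM; [exact: cvg_cst|exact: cvg_id].
- split.
  + by move=> x _; have [] := dF x.
  + exact/cvg_at_right_filter/cF.
  + exact/cvg_at_left_filter/cF.
- by move=> x _; rewrite derive1E; have [_] := dF x.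
Qed.

End renewal.

(** * Measurability of paths driven by random clocks *)

Section clocks.
Context (R : realType).

Definition clocks d (T : measurableType d) (K : nat) (E : T -> seq R) :=
  [/\ forall w, size (E w) = K, forall w, all (> 0) (E w) &
      forall i, measurable_fun setT (fun w => nth 0 (E w) i)].

Context (S : finType) (f : S -> S).

(** The time [tau] is random because the induction on the clocks subtracts the first of them from
    it. *)
Lemma measurable_clock_path d (T : measurableType d) (K : nat)
    (E : T -> seq R) (tau : T -> R) s u :
  (forall w, size (E w) = K) ->
  (forall i, measurable_fun setT (fun w => nth 0 (E w) i)) ->
  measurable_fun setT tau ->
  measurable [set w | clock_path f (E w) s (tau w) = u].
Proof.
have mC (Q : Prop) : measurable [set _ : T | Q].
  have [q|q] := pselect Q.
    by rewrite (_ : [set _ | _] = setT)//; apply/seteqP; split.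
  by rewrite (_ : [set _ | _] = set0)//; apply/seteqP; split.
elim: K E tau s => [|K IH] E tau s sE mE mtau.
  rewrite (_ : [set _ | _] = [set w | s = u])//.
  by apply/seteqP; split => w /=; have := sE w; case: (E w).
pose A := [set w | tau w < nth 0 (E w) 0].
have mA : measurable A.
  rewrite -[A]setTI; have := @measurable_fun_ltr _ _ _ _ tau (fun w => nth 0 (E w) 0) mtau (mE 0%N).
  by move/(_ measurableT [set true]); apply.
have -> : [set w | clock_path f (E w) s (tau w) = u] =
    (A `&` [set w | s = u]) `|`
    (~` A `&` [set w | clock_path f (behead (E w)) (f s) (tau w - nth 0 (E w) 0) = u]).
  apply/seteqP; split => w /=; have := sE w; rewrite /A/=; case: (E w) => //= e es _.
    by case: ltP => te; [left|right; split => //; apply/negP; rewrite -leNgt].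
  by case: ltP => te [[]|[]].
apply: measurableU; first exact: measurableI.
apply: measurableI; first exact: measurableC.
apply: IH.
- by move=> w; rewrite size_behead sE.
- move=> i; under eq_fun do rewrite nth_behead; exact: mE.
- exact: measurable_funB.
Qed.

Lemma measurable_visits d (T : measurableType d) (K : nat)
    (E : T -> seq R) b s L :
  (forall w, size (E w) = K) ->
  (forall i, measurable_fun setT (fun w => nth 0 (E w) i)) ->
  measurable [set w | visits (clock_path f (E w) s) b L].
Proof.
move=> sE mE; elim: L b => [|[h u] L IH] b /=.
  by rewrite (_ : [set _ | _] = setT)//; apply/seteqP; split.
apply: measurableI; last exact: IH.
exact: measurable_clock_path.
Qed.

End clocks.

(** * Conditioning on the first clock *)

Section first_clock.
Context (R : realType) (lam : R) (lam0 : 0 < lam).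
Context (Q : probability (measurableTypeR R) R)
  (QE : forall A, Q A = exponential_prob lam A).
Context (d : measure_display) (T : measurableType d) (P : probability T R).
Context (K : nat) (E : T -> seq R) (cE : clocks K E).

(* Makes the clocks positive for every outcome, not only almost surely: the
   paths have to start in the initial state everywhere. *)
Definition pos_draw (x : R) : R := if 0 < x then x else 1.

Lemma pos_draw_gt0 x : 0 < pos_draw x.
Proof. by rewrite /pos_draw; case: ifP. Qed.

Lemma measurable_pos_draw :
  measurable_fun setT (pos_draw : measurableTypeR R -> R).
Proof.
apply: measurable_fun_ifT => //.
exact: (@measurable_fun_ltr _ _ _ _ (cst 0) id).
Qed.

Lemma clocks_cons : clocks K.+1 
  (fun y : measurableTypeR R * T => pos_draw y.1 :: E y.2).
Proof.
have [sE pE mE] := cE.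
split=> [w|w|[|i]] /=.
- by rewrite sE.
- by rewrite pos_draw_gt0 pE.
- exact: (measurableT_comp measurable_pos_draw (@measurable_fst _ _ _ _)).
- exact: (measurableT_comp (mE i) (@measurable_snd _ _ _ _)).
Qed.

Context (S : finType) (f : S -> S).

Definition first_clock_prob s L (x : measurableTypeR R) : \bar R :=
  P [set w | visits (clock_path f (x :: E w) s) 0 L].

Lemma measurable_first_clock_set s L :
  measurable [set y : measurableTypeR R * T |
    visits (clock_path f (y.1 :: E y.2) s) 0 L].
Proof.
have [sE pE mE] := cE.
apply: (@measurable_visits _ _ _ _ _ K.+1 (fun y : measurableTypeR R * T => y.1 :: E y.2)).
  by move=> w /=; rewrite sE.
case=> [|i] /=.
  exact: (@measurable_fst _ _ _ _).
exact: (measurableT_comp (mE i) (@measurable_snd _ _ _ _)).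
Qed.

Lemma measurable_first_clock_prob s L :
  measurable_fun setT (first_clock_prob s L).
Proof.
have := measurable_fun_xsection P (measurable_first_clock_set s L).
congr measurable_fun; apply/funext => x /=; congr (P _).
by apply/seteqP; split => w /=; rewrite /xsection/= inE.
Qed.

Lemma measurable_visits_cons x s L :
  measurable [set w | visits (clock_path f (x :: E w) s) 0 L].
Proof.
have [sE pE mE] := cE.
apply: (@measurable_visits _ _ _ _ _ K.+1 (fun w => x :: E w)) => [w|[|i]] /=.
- by rewrite sE.
- exact: measurable_cst.
- exact: mE.
Qed.

Lemma first_clock_prob_ge0 s L x : (0 <= first_clock_prob s L x)%E.
Proof. exact: measure_ge0. Qed.

Lemma first_clock_prob_le1 s L x : (first_clock_prob s L x <= 1)%E.
Proof. exact/probability_le1/measurable_visits_cons. Qed.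

(** The product measure is an integral over sections, and [pos_draw] differs from the identity only
    on []-oo, 0]], a null set of [Q]. *)
Lemma visits_first_clock s L :
  (Q \x P)%E [set y | visits (clock_path f (pos_draw y.1 :: E y.2) s) 0 L]
  = (\int[Q]_(x in `]0%R, +oo[) first_clock_prob s L x)%E.
Proof.
rewrite /product_measure1.
transitivity (\int[Q]_x (first_clock_prob s L (pos_draw x)))%E.
  apply: eq_integral => x _ /=; congr (P _).
  by apply/seteqP; split => w /=; rewrite /xsection/= inE.
rewrite (@ge0_negligible_integral _ _ _ Q setT `]-oo, 0%R]%classic)//; last 2 first.
- apply: measurableT_comp; first exact: measurable_first_clock_prob.
  exact: measurable_pos_draw.
- exact: exponential_law_le0 QE.
rewrite setTD setCitvl; apply: eq_integral => x; rewrite inE/= in_itv/= andbT => x0.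
by rewrite /pos_draw x0.
Qed.

Lemma integral_first_clock_near (a b : R) s u L (c : R) N z :
  (forall s, iter N f s = z) -> 0 <= a ->
  (forall x, 0 <= x -> x <= a -> first_clock_prob s L x =
    (poisson_trans f z N lam (a - x) (f s) u * c)%:E) ->
  (\int[Q]_(x in `]0%R, a]) first_clock_prob s L x =
  ((poisson_trans f z N lam a s u - expR (- lam * a) * (s == u)%:R) * c)%:E)%E.
Proof.
move=> fN a0 H.
have mh := measurable_first_clock_prob s L.
rewrite (integral_exponential_law QE)//; last first.
  apply/integrableP; split; first exact: measurable_funTS.
  apply: (@le_lt_trans _ _ (\int[Q]_(x in `]0%R, a]) 1)%E).
    apply: ge0_le_integral => //.
    - by apply: measurableT_comp => //; exact: measurable_funTS.
    - by move=> x _; rewrite gee0_abs ?first_clock_prob_ge0// first_clock_prob_le1.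
  rewrite integral_cst//= mul1e.
  by rewrite -ge0_fin_numE// fin_num_measure.
rewrite integral_itv_obnd_cbnd; last first.
  apply: emeasurable_funM; first exact: measurable_funTS.
  by apply: measurable_funTS; apply/measurable_EFinP; exact: measurable_exponential_pdf.
rewrite -(@integral_renewal _ _ f z N)//; apply: eq_integral => x.
by rewrite inE/= in_itv/= => /andP[x0 xa]; rewrite H.
Qed.

(** Two inductions are nested: an early ring consumes a clock and falls under the hypothesis on [K];
    a late one consumes an observation and falls under the induction on [L], with as many clocks as
    before. In the total, the terms with [expR (- lam * h) * (s == u)%:R] cancel. *)
Lemma integral_first_clock N z s L :
  (forall s, iter N f s = z) -> 
  (forall s, iter K f s = z -> forall L, all (fun hu => 0 <= hu.1) L ->
    P [set w | visits (clock_path f (E w) s) 0 L] =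
    (visit_prob (poisson_trans f z N lam) s L)%:E) ->
  iter K.+1 f s = z -> all (fun hu => 0 <= hu.1) L ->
  (\int[Q]_(x in `]0%R, +oo[) first_clock_prob s L x =
   (visit_prob (poisson_trans f z N lam) s L)%:E)%E.
Proof.
move=> fN IHK sz; elim: L => [|[h u] L IH] /=.
  move=> _.
  transitivity (\int[Q]_(x in `]0%R, +oo[) 1)%E.
    apply: eq_integral => x _; rewrite /first_clock_prob/=.
    by rewrite (_ : [set _ | _] = setT) ?probability_setT//; apply/seteqP; split.
  rewrite integral_cst//= mul1e.
  rewrite -setCitvl probability_setC//.
  by rewrite (exponential_law_le0 QE) sube0.
move=> /andP[h0 L0].
have mh := measurable_first_clock_prob s ((h, u) :: L).
have -> : `]0, +oo[%classic = `]0, h] `|` `]h, +oo[ :> set (measurableTypeR R).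
  by rewrite -itv_bndbnd_setU// bnd_simp.
rewrite ge0_integral_setU//; last 2 first.
- exact: measurable_funTS.
- apply/disj_setPS => x /=; rewrite !in_itv/= andbT => -[/andP[_ xh] hx].
  by have := le_lt_trans xh hx; rewrite ltxx.
rewrite (@integral_first_clock_near h 0 s u _ (visit_prob (poisson_trans f z N lam) u L) N z)//; last first.
  (* The target is itself a [visit_prob] from [f s], with the first increment shortened by the time
     [x] spent before the ring. *)
  move=> x x0 xh; rewrite -[RHS]/((visit_prob (poisson_trans f z N lam) (f s) ((h - x, u) :: L))%:E).
  rewrite -IHK; last 2 first.
  - by rewrite -iterSr.
  - by rewrite /= subr_ge0 xh.
  have path_hx w t : 0 <= t ->
      clock_path f (x :: E w) s (h + t) = clock_path f (E w) (f s) (h - x + t).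
    move=> t0 /=; rewrite ifF; last by apply/negbTE; rewrite -leNgt; lra.
    by congr clock_path; ring.
  have path_h w : clock_path f (x :: E w) s h = clock_path f (E w) (f s) (h - x).
    by rewrite -[h in LHS]addr0 path_hx// addr0.
  have vis w := visits_eq L0 (path_hx w).
  congr (P _); apply/seteqP; split => w; rewrite /mkset !visits_cons !add0r path_h.
    by move=> -[<- /(iffLR (vis w))].
  by move=> -[<- /(iffRL (vis w))].
have mL := measurable_first_clock_prob s L.
(* Before the first ring the path is still in [s], so this part vanishes unless [u = s]; the
   residual clock [x - h] then takes over. *)
rewrite [X in (_ + X)%E = _](_ : _ = (((s == u)%:R)%:E *
    \int[Q]_(x in `]h, +oo[) first_clock_prob s L (x - h)%R)%E); last first.
  have [su|su] := eqVneq s u; last first.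
    rewrite mul0e integral0_eq// => x; rewrite /= in_itv/= andbT => hx.
    rewrite /first_clock_prob/= add0r hx (_ : [set _ | _] = set0) ?measure0//.
    by apply/seteqP; split => // w /= [/eqP]; rewrite (negbTE su).
  rewrite mul1e; apply: eq_integral => x; rewrite inE /= in_itv/= andbT => hx.
  have path_hx w t : 0 <= t ->
      clock_path f (x :: E w) s (h + t) = clock_path f (x - h :: E w) s (0 + t).
    by move=> t0 /=; rewrite add0r ltrBrDl; case: ifP => // _; congr clock_path; ring.
  have path_h w : clock_path f (x :: E w) s h = s by rewrite /= hx.
  have vis w := visits_eq L0 (path_hx w).
  rewrite /first_clock_prob; congr (P _); apply/seteqP; split => w;
    rewrite /mkset visits_cons add0r path_h -su.
    by move=> -[_ /(iffLR (vis w))].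
  by move=> /(iffRL (vis w)).
rewrite (exponential_memoryless QE h0 mL)//.
rewrite IH// -!EFinM -EFinD; congr EFin.
case: (eqVneq s u) => [->|su] /=; ring.
Qed.

End first_clock.

(** The clocks come before the state space and the map, so that the same clocks can drive the
    phase-type chains and the countdown which reveals the Erlang law. [N] is separate from [K]
    because the induction on [K] must leave [poisson_trans] unchanged. *)
Theorem markov_clocks (R : realType) (lam : R) (K : nat) : 0 < lam ->
  exists (d : measure_display) (T : measurableType d) (P : probability T R)
    (E : T -> seq R), clocks K E /\
  forall (S : finType) (f : S -> S) (z : S) (N : nat),
    (forall s, iter N f s = z) ->
    forall s, iter K f s = z -> forall L, all (fun hu => 0 <= hu.1) L ->
    P [set w | visits (clock_path f (E w) s) 0 L] =
    (visit_prob (poisson_trans f z N lam) s L)%:E.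
Proof.
move=> lam0; elim: K => [|K [d [T [P [E [cE IH]]]]]].
  exists _, (unit : measurableType _), (dirac tt), (fun _ => [::]); split.
    by split => //= i; under eq_fun do rewrite nth_nil; exact: measurable_cst.
  move=> S f z N fN s /= -> L _.
  have fz : f z = z by rewrite -{1}(fN z) -iterS iterSr fN.
  have V b : visits (fun=> z) b L <-> all (fun hu => hu.2 == z) L.
    elim: L b => [|[h u] L IH] b //=; rewrite IH; split.
      by move=> [<- ->]; rewrite eqxx.
    by move=> /andP[/eqP].
  have -> : [set w : unit | visits (clock_path f [::] z) 0 L] =
      [set _ | all (fun hu => hu.2 == z) L].
    by apply/seteqP; split => w /= /V.
  rewrite (_ : visit_prob _ _ _ = (all (fun hu => hu.2 == z) L)%:R); last first.
    elim: L {V} => [|[h u] L IH] //=; rewrite poisson_trans_z// eq_sym.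
    by case: eqP => [->|_]; rewrite ?mul1r ?mul0r// IH.
  case: (all _ _).
    by rewrite (_ : [set _ | _] = setT) ?probability_setT//; apply/seteqP; split.
  by rewrite (_ : [set _ | _] = set0) ?measure0//; apply/seteqP; split.
have [Q QE] := exponential_law lam0.
exists _, (measurableTypeR R * T)%type, (Q \x P)%E,
  (fun y => pos_draw y.1 :: E y.2); split; first exact: clocks_cons.
move=> S f z N fN s sz L L0.
have IH' s' : iter K f s' = z -> forall L', all (fun hu => 0 <= hu.1) L' ->
    P [set w | visits (clock_path f (E w) s') 0 L'] =
    (visit_prob (poisson_trans f z N lam) s' L')%:E by exact: IH.
exact: (etrans (visits_first_clock QE P cE f s L)
  (integral_first_clock QE cE fN IH' sz L0)).
Qed.

(** * Erlang laws *)

Section absorption_probability.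
Context (R : realType) (S : finType) (f : S -> S) (z : S) (N : nat) (lam : R).
Hypothesis fN : forall s, iter N f s = z.
Hypothesis fz : f z = z.
Context (k : nat) (s : S).
Hypothesis sk : iter k.+1 f s = z.
Hypothesis sj : forall j, (j < k.+1)%N -> iter j f s != z.

Let iter_eq_z n : (iter n f s == z) = (k < n)%N.
Proof.
have [kn|nk] := ltnP k n; last exact/negbTE/sj.
by rewrite -(subnK kn) iterD sk iter_absorbed ?eqxx.
Qed.

(** Absorption takes [k + 1] steps from [s] and [k] from [f s], so the two sums differ in the term
    of index [k] only. By the backward equation the absorption probability then has derivative
    [lam * pois lam k], the Erlang density of shape [k + 1]. *)
Lemma poisson_trans_backward_absorbed t :
  poisson_trans f z N lam t (f s) z - poisson_trans f z N lam t s z = pois lam k t.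
Proof.
have kN : (k < N)%N by rewrite -iter_eq_z fN.
rewrite /poisson_trans opprD addrACA subrr addr0 -sumrB.
rewrite (bigD1 (Ordinal kN))//= big1 ?addr0 => [|i ik].
  by rewrite -iterSr !iter_eq_z ltnn ltnSn eqxx/=; ring.
rewrite -iterSr !iter_eq_z ltnS leq_eqVlt.
have /negbTE -> : k != i by rewrite eq_sym; apply: contraNneq ik => ki; apply/eqP/val_inj.
by rewrite /= subrr.
Qed.

Lemma is_derive_absorbed (t : R) :
  is_derive t (1 : R) (fun x => poisson_trans f z N lam x s z) (lam * pois lam k t).
Proof.
rewrite -poisson_trans_backward_absorbed.
exact: is_derive_poisson_trans.
Qed.

End absorption_probability.

Section erlang.
Context (R : realType) (k : nat) (lam : R) (lam0 : 0 < lam).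
Local Notation mu := (@lebesgue_measure R).

Lemma erlang_pdf_ge0 x : 0 <= erlang_pdf k lam x.
Proof.
apply: restrict_ge0 => {}x; rewrite /= in_itv/= andbT => x0.
by rewrite divr_ge0// !mulr_ge0 ?expR_ge0// exprn_ge0// ltW.
Qed.

Lemma measurable_erlang_pdf :
  measurable_fun setT (erlang_pdf k lam : measurableTypeR R -> R).
Proof.
apply/measurable_restrict => //; apply: measurable_funTS.
apply: measurable_funM => //; apply: measurable_funM.
  by apply: measurable_funM => //; exact: measurable_funX.
by apply: measurableT_comp => //; exact: measurable_funM.
Qed.

Lemma measurable_erlang_pdfE (D : set (measurableTypeR R)) :
  measurable_fun D (fun x : measurableTypeR R => (erlang_pdf k lam x)%:E).
Proof. by apply: measurable_funTS; apply/measurable_EFinP; exact: measurable_erlang_pdf. Qed.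

(* [erlang_prob] on [measurableTypeR R]: the library puts the Lebesgue measure on
   that type, whose display differs from the one of [R]. *)
Definition erlang_measure (V : set (measurableTypeR R)) : \bar R :=
  erlang_prob k lam V.

Let erlang0 : erlang_measure set0 = 0%E.
Proof. by rewrite /erlang_measure /erlang_prob integral_set0. Qed.

Let erlang_ge0 A : (0 <= erlang_measure A)%E.
Proof. by apply: integral_ge0 => x _; rewrite lee_fin erlang_pdf_ge0. Qed.

Let erlang_sigma_additive : semi_sigma_additive erlang_measure.
Proof.
move=> /= F mF tF mUF; apply: cvg_toP.
  apply: ereal_nondecreasing_is_cvgn => m n mn.
  by apply: lee_sum_nneg_natr => // j _ _; exact: erlang_ge0.
rewrite /erlang_measure /erlang_prob ge0_integral_bigcup//=.
- exact: measurable_erlang_pdfE.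
- by move=> x _; rewrite lee_fin erlang_pdf_ge0.
Qed.

HB.instance Definition _ := isMeasure.Build _ _ _
  erlang_measure erlang0 erlang_ge0 erlang_sigma_additive.

End erlang.

Section erlang_cdf.
Context (R : realType) (lam : R) (lam0 : 0 < lam).
Context (S : finType) (f : S -> S) (z : S) (N : nat).
Hypothesis fN : forall s, iter N f s = z.
Hypothesis fz : f z = z.
Context (k : nat) (s : S).
Hypothesis sk : iter k.+1 f s = z.
Hypothesis sj : forall j, (j < k.+1)%N -> iter j f s != z.
Local Notation mu := (@lebesgue_measure R).

Lemma erlang_prob_lt0 (a : R) : a <= 0 -> erlang_prob k.+1 lam `]-oo, a[%classic = 0%E.
Proof.
move=> a0; rewrite /erlang_prob integral0_eq// => x /=; rewrite in_itv/= => xa.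
rewrite /erlang_pdf patchE ifF//; apply/negbTE; rewrite notin_setE/= in_itv/= andbT.
by apply/negP; rewrite -ltNge (lt_le_trans xa).
Qed.

Lemma erlang_prob_le0 (a : R) : a <= 0 -> erlang_prob k.+1 lam `]-oo, a]%classic = 0%E.
Proof.
move=> a0; rewrite -(erlang_prob_lt0 a0) /erlang_prob.
by apply/esym/integral_itv_bndo_bndc; exact: measurable_erlang_pdfE.
Qed.

Lemma erlang_cdf (a : R) : 0 < a ->
  erlang_prob k.+1 lam `]-oo, a]%classic = (poisson_trans f z N lam a s z)%:E.
Proof.
move=> a0.
have -> : `]-oo, a]%classic = `]-oo, 0%R[ `|` `[0, a] :> set (measurableTypeR R).
  by rewrite -itv_bndbnd_setU// bnd_simp ltW.
rewrite -[LHS]/(erlang_measure k.+1 lam _).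
rewrite (@measureU _ _ _ (erlang_measure k.+1 lam))//; last first.
  apply/seteqP; split => // x /=; rewrite !in_itv/= => -[x0 /andP[x1 _]].
  by move: x0; rewrite ltNge x1.
rewrite [X in (X + _)%E](erlang_prob_lt0 (lexx _)) add0e.
pose F x := poisson_trans f z N lam x s z.
have dF (x : R) : is_derive x (1 : R) F (lam * pois lam k x).
  exact: is_derive_absorbed.
have cF : continuous F := continuous_is_derive dF.
rewrite /erlang_measure /erlang_prob.
transitivity (\int[mu]_(x in `[0%R, a]) (lam * pois lam k x)%:E)%E.
  apply: eq_integral => x; rewrite inE/= in_itv/= => /andP[x0 _].
  rewrite /erlang_pdf patchE ifT; last by rewrite inE/= in_itv/= x0.
  by rewrite /pois/= exprMn exprS mulNr; congr EFin; ring.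
rewrite (@continuous_FTC2 _ _ F)//.
- have /negbTE sz : s != z := sj (ltn0Sn k).
  by rewrite /F poisson_trans_0// sz sube0.
- apply: continuous_subspaceT => x.
  apply: cvgM; first exact: cvg_cst.
  have dp (y : R) : exists D, is_derive y (1 : R) (pois lam k) D.
    by case: k => [|n]; eexists; [exact: is_derive_pois0|exact: is_derive_poisS].
  apply: differentiable_continuous; apply/derivable1_diffP.
  by have [D []] := dp x.
- split.
  + by move=> x _; have [] := dF x.
  + exact/cvg_at_right_filter/cF.
  + exact/cvg_at_left_filter/cF.
- by move=> x _; rewrite derive1E; have [_] := dF x.
Qed.

End erlang_cdf.

(** * Sums of clocks have Erlang laws *)

Section sum_of_clocks.
Context (R : realType) (lam : R) (lam0 : 0 < lam).
Context (d : measure_display) (T : measurableType d) (P : probability T R)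
  (K : nat) (E : T -> seq R) (cE : clocks K E).
Hypothesis markovE : forall (S : finType) (f : S -> S) (z : S) (N : nat),
    (forall s, iter N f s = z) ->
    forall s, iter K f s = z -> forall L, all (fun hu => 0 <= hu.1) L ->
    P [set w | visits (clock_path f (E w) s) 0 L] =
    (visit_prob (poisson_trans f z N lam) s L)%:E.

Lemma measurable_sum_clocks k :
  measurable_fun setT (fun w => \sum_(e <- take k (E w)) e).
Proof.
have [sE _ mE] := cE.
rewrite (_ : (fun w => _) = fun w => \sum_(i < minn k K) nth 0 (E w) i).
  exact: measurable_sum.
apply/funext => w.
rewrite (big_nth 0) size_take -/(minn k (size (E w))) sE big_mkord.
apply: eq_bigr => i _; rewrite nth_take//.
by have := ltn_ord i; rewrite leq_min => /andP[].
Qed.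

Lemma sum_clocks_gt0 k w : (0 < k <= K)%N -> 0 < \sum_(e <- take k (E w)) e.
Proof.
have [sE pE _] := cE; move=> /andP[k0 kK].
have := pE w; have := sE w; case: (E w) => [|e es] /=.
  by move=> K0; move: (leq_trans k0 kK); rewrite -K0.
case: k k0 kK => // k _ _ _ /andP[e0 es0] /=; rewrite big_cons.
rewrite ltr_pwDl// big_seq sumr_ge0// => x /mem_take xes.
exact/ltW/(allP es0).
Qed.

(** The sum of the first [k + 1] clocks is the absorption time of a countdown, whose absorption
    probability is the Erlang distribution function by [erlang_cdf]. *)
Lemma sum_clocks_cdf k (a : R) : (k < K)%N -> 
  P [set w | \sum_(e <- take k.+1 (E w)) e <= a] =
  erlang_prob k.+1 lam `]-oo, a]%classic.
Proof.
move=> kK; have [sE pE mE] := cE.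
have [a0|a0] := leP a 0.
  rewrite erlang_prob_le0// (_ : [set _ | _] = set0) ?measure0//.
  apply/seteqP; split => // w /=; apply/negP; rewrite -ltNge.
  by rewrite (le_lt_trans a0)// sum_clocks_gt0.
(* The countdown from [ord_max], of value [k + 1], to [ord0], which is fixed because the predecessor
   of 0 is 0. *)
pose f (i : 'I_k.+2) : 'I_k.+2 := inord i.-1.
have iterf n i : iter n f i = inord (i - n).
  elim: n => [|n IH]; first by rewrite subn0 inord_val.
  rewrite iterS IH /f inordK ?subnS// (leq_ltn_trans (leq_subr _ _))//.
have fN s : iter k.+1 f s = ord0.
  rewrite iterf; apply/val_inj; rewrite /= inordK; have := ltn_ord s; rewrite ltnS => sk.
    by apply/eqP; rewrite subn_eq0.
  by rewrite (eqP (_ : s - k.+1 == 0)%N)// subn_eq0.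
have fz : f ord0 = ord0 by apply/val_inj; rewrite /= inordK.
have sj j : (j < k.+1)%N -> iter j f ord_max != ord0.
  move=> jk; rewrite iterf; apply/eqP => /(congr1 val)/=; rewrite inordK.
    by move/eqP; rewrite subn_eq0 leqNgt jk.
  by rewrite ltnS leq_subr.
rewrite (erlang_cdf lam0 fN fz (fN ord_max) sj)//.
have iK : iter K f ord_max = ord0.
  by rewrite -(subnK kK) iterD fN iter_absorbed.
have := markovE fN iK (L := [:: (a, ord0)]); rewrite /= ltW// mulr1 => <- //.
congr (P _); apply/seteqP; split => w /=; rewrite add0r.
  move=> H; split => //; apply/(clock_path_absorbed fz (k := k.+1)) => //.
  - exact: ltW.
  - by rewrite sE.
move=> [H _]; apply/(clock_path_absorbed fz (k := k.+1) (s := ord_max)) => //.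
- exact: ltW.
- by rewrite sE.
Qed.

Lemma sum_clocks_erlang k (B : set R) : (0 < k <= K)%N -> measurable B ->
  P [set w | B (\sum_(e <- take k (E w)) e)] = erlang_prob k lam B.
Proof.
case: k => // k /= kK mB.
pose X (w : T) : measurableTypeR R := \sum_(e <- take k.+1 (E w)) e.
have mX : measurable_fun setT X := measurable_sum_clocks k.+1.
apply: (@finite_measure_cdf_unique R (pushforward P X) (erlang_measure k.+1 lam)) => // a.
  exact: sum_clocks_cdf.
change (P (X @^-1` `]-oo, a]%classic) < +oo)%E.
rewrite -ge0_fin_numE//; apply: fin_num_measure => //.
by rewrite -[X in measurable X]setTI; exact: mX.
Qed.

End sum_of_clocks.

(** The density has total mass 1 because it is that of a sum of clocks. *)
Lemma erlang_prob_setT (R : realType) (lam : R) k : 0 < lam -> (0 < k)%N ->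
  erlang_prob k lam setT = 1%E.
Proof.
move=> lam0 k0; have [d [T [P [E [cE mE]]]]] := markov_clocks k lam0.
rewrite -(sum_clocks_erlang lam0 cE mE)// ?k0 ?leqnn//.
by rewrite (_ : [set _ | _] = setT) ?probability_setT//; apply/seteqP; split.
Qed.

(** Reduces the moments of an Erlang law to total masses of Erlang laws of higher shape. *)
Lemma mul_erlang_pdf (R : realType) (lam : R) k x : 0 < lam -> (0 < k)%N ->
  x * erlang_pdf k lam x = k%:R / lam * erlang_pdf k.+1 lam x.
Proof.
move=> lam0; case: k => // k _.
rewrite /erlang_pdf !patchE; case: ifPn => _; last by rewrite !mulr0.
rewrite /= factS natrM.
have n0 : k`!%:R != 0 :> R by rewrite pnatr_eq0 -lt0n fact_gt0.
have n1 : k.+1%:R != 0 :> R by rewrite pnatr_eq0.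
have l0 : lam != 0 by rewrite gt_eqF.
rewrite !exprS; move: (k`!%:R) (k.+1%:R) n0 n1 (x ^+ k) (expR _) (lam ^+ k) => a b a0 b0 y e l.
by field; rewrite a0 b0 l0.
Qed.

Lemma erlang_chebyshev (R : realType) (lam eps : R) k : 0 < lam -> (0 < k)%N -> 0 < eps ->
  (erlang_prob k lam [set x : R | (eps < `|x - k%:R / lam|)%R] <=
  (k%:R / lam ^+ 2 / eps ^+ 2)%:E)%E.
Proof.
move=> lam0 k0 e0.
pose mu := @lebesgue_measure R.
pose c := k%:R / lam.
have c0 : 0 <= c by rewrite divr_ge0// ltW.
have pdf1 j (a : R) : (0 < j)%N -> 0 <= a -> (\int[mu]_x (a * erlang_pdf j lam x)%:E = a%:E)%E.
  move=> j0 a0; under eq_integral do rewrite EFinM.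
  rewrite ge0_integralZl//; last 2 first.
  - exact: measurable_erlang_pdfE.
  - by move=> x _; rewrite lee_fin erlang_pdf_ge0.
  by rewrite -[X in (_ * X)%E]/(erlang_prob j lam setT) erlang_prob_setT// mule1.
have mp j : measurable_fun setT (erlang_pdf j lam : measurableTypeR R -> R).
  exact: measurable_erlang_pdf.
have mV : measurable_fun setT (fun x : measurableTypeR R => (x - c) ^+ 2 * erlang_pdf k lam x : R).
  by apply: measurable_funM => //; apply: measurable_funX; exact: measurable_funB.
pose V := (\int[mu]_x ((x - c) ^+ 2 * erlang_pdf k lam x)%:E)%E.
(* The integrated form of [(x - c) ^+ 2 + 2 * c * x = x ^+ 2 + c ^+ 2], arranged so that every
   integrand is nonnegative. It yields the variance [c / lam]. *)
have VE : (V + (2 * c ^+ 2)%:E = (c * (k.+1%:R / lam) + c ^+ 2)%:E)%E.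
  rewrite EFinD.
  have q0 : 0 <= c * (k.+1%:R / lam) by rewrite mulr_ge0// divr_ge0// ltW.
  rewrite -(pdf1 k.+2 (c * (k.+1%:R / lam)))// -(pdf1 k (c ^+ 2)) ?sqr_ge0//.
  rewrite -(pdf1 k.+1 (2 * c ^+ 2))//; last by rewrite mulr_ge0// sqr_ge0.
  rewrite /V -ge0_integralD//; last 4 first.
  - by move=> x _; rewrite lee_fin mulr_ge0 ?sqr_ge0 ?erlang_pdf_ge0.
  - exact/measurable_EFinP.
  - by move=> x _; rewrite lee_fin mulr_ge0 ?erlang_pdf_ge0// mulr_ge0// sqr_ge0.
  - by apply/measurable_EFinP; exact: measurable_funM.
  rewrite -ge0_integralD//; last 4 first.
  - by move=> x _; rewrite lee_fin mulr_ge0 ?erlang_pdf_ge0.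
  - by apply/measurable_EFinP; exact: measurable_funM.
  - by move=> x _; rewrite lee_fin mulr_ge0 ?sqr_ge0 ?erlang_pdf_ge0.
  - by apply/measurable_EFinP; exact: measurable_funM.
  apply: eq_integral => x _; rewrite -!EFinD; congr EFin.
  have H1 := mul_erlang_pdf x lam0 k0.
  have H2 := mul_erlang_pdf x lam0 (ltn0Sn k).
  rewrite -[c * (k.+1%:R / lam) * _]mulrA -H2.
  rewrite (_ : c * (x * _) = x * (c * erlang_pdf k.+1 lam x)); last by ring.
  rewrite (_ : 2 * c ^+ 2 * erlang_pdf k.+1 lam x = 2 * c * (c * erlang_pdf k.+1 lam x)); last by ring.
  by rewrite /c -H1; ring.
have {}VE : V = (c / lam)%:E.
  have Vfin : V \is a fin_num.
    rewrite fin_numE; apply/andP; split; apply/eqP => VV; by rewrite VV in VE.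
  rewrite -(fineK Vfin); congr EFin; move: VE; rewrite -(fineK Vfin) -EFinD => -[] VE.
  have -> : fine V = c * (k.+1%:R / lam) + c ^+ 2 - 2 * c ^+ 2 by rewrite -VE; ring.
  by rewrite /c -(natr1 k) /=; field; rewrite gt_eqF.
have mA : measurable [set x : measurableTypeR R | (eps < `|x - c|)%R].
  rewrite -[X in measurable X]setTI.
  have mf : measurable_fun setT (fun x : measurableTypeR R => `|x - c|%R : R).
    by apply: measurableT_comp => //; exact: measurable_funB.
  have := @measurable_fun_ltr _ _ _ _ (cst eps) _ (measurable_cst _) mf.
  by move/(_ measurableT [set true]); apply.
have e2 : 0 < eps ^+ 2 by rewrite exprn_gt0.
have -> : k%:R / lam ^+ 2 / eps ^+ 2 = (eps ^+ 2)^-1 * (c / lam).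
  by rewrite /c; field; rewrite !gt_eqF.
rewrite EFinM lee_pdivlMl//.
rewrite -VE /V /erlang_prob -ge0_integralZl//; last 3 first.
- exact: measurable_erlang_pdfE.
- by move=> x _; rewrite lee_fin erlang_pdf_ge0.
- by rewrite lee_fin ltW.
apply: (@le_trans _ _ (\int[mu]_(x in [set x : measurableTypeR R | (eps < `|x - c|)%R])
    ((x - c) ^+ 2 * erlang_pdf k lam x)%:E)%E).
  apply: ge0_le_integral => //.
  - by move=> x _; rewrite -EFinM lee_fin mulr_ge0 ?erlang_pdf_ge0// ltW.
  - by apply: measurable_funTS; apply/measurable_EFinP; exact: measurable_funM.
  - by apply: measurable_funTS; exact/measurable_EFinP.
  - move=> x /= xe; rewrite -EFinM lee_fin ler_wpM2r ?erlang_pdf_ge0//.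
    rewrite -(real_normK (num_real (x - c))) ler_sqr ?nnegrE ?normr_ge0//.
      exact: ltW.
    exact: ltW.
apply: ge0_subset_integral => //.
- exact/measurable_EFinP.
- by move=> x _; rewrite lee_fin mulr_ge0 ?sqr_ge0 ?erlang_pdf_ge0.
Qed.

(** * The phase-type vector *)

Lemma total_probability (R : realType) d (T : measurableType d)
    (P : probability T R) (S : finType) (g : T -> S) (A : set T) :
  (forall v, measurable [set w | g w = v]) -> measurable A ->
  P A = (\sum_v P (A `&` [set w | g w = v]))%E.
Proof.
move=> mg mA.
have {1}-> : A = \big[setU/set0]_(i < #|S|) (A `&` [set w | g w = enum_val i]).
  rewrite -bigcup_seq.
  apply/seteqP; split => w /=.
    by move=> Aw; exists (enum_rank (g w)); rewrite /= ?mem_index_enum ?enum_rankK.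
  by move=> [v _ []].
rewrite measure_bigsetU_ord//=.
- by rewrite -(@big_enum_val _ _ _ _ S (fun v => P (A `&` [set w | g w = v]))); apply: eq_bigl.
- by move=> v; exact: measurableI.
- apply/trivIsetP => u v _ _ uv; apply/seteqP; split => // w /= [[_ ->] [_ /enum_val_inj wv]].
  by rewrite wv eqxx in uv.
Qed.

Lemma power_space (R : realType) d (T : measurableType d) (P : probability T R)
    (n : nat) :
  exists (d' : measure_display) (T' : measurableType d')
    (P' : probability T' R) (X : 'I_n -> T' -> T),
  (forall i, measurable_fun setT (X i)) /\
  forall A : 'I_n -> set T, (forall i, measurable (A i)) ->
    P' [set w | forall i, A i (X i w)] = (\prod_(i < n) P (A i))%E.
Proof.
elim: n => [|n [d' [T' [P' [X [mX XE]]]]]].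
  exists _, T, P, (fun _ => id); split=> // A mA.
  rewrite big_ord0 (_ : [set _ | _] = setT) ?probability_setT//.
  by apply/seteqP; split => // w _ [].
exists _, (T * T')%type, (P \x P')%E,
  (fun i w => if unlift ord0 i is Some j then X j w.2 else w.1); split.
  move=> i; case: unliftP => [j _|_].
    exact: (measurableT_comp (mX j) (@measurable_snd _ _ _ _)).
  exact: measurable_fst.
move=> A mA; rewrite big_ord_recl.
have mB : measurable [set w | forall i, A (lift ord0 i) (X i w)].
  rewrite (_ : [set _ | _] = \bigcap_(i in [set: 'I_n]) (X i @^-1` A (lift ord0 i))).
    apply: fin_bigcap_measurable => // i _.
    by rewrite -[X in measurable X]setTI; exact: mX.
  by apply/seteqP; split => w /= H i; [move=> _; exact: H|exact: (H i)].
rewrite -(XE (fun i => A (lift ord0 i)))// -product_measure1E//.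
congr ((P \x P')%E _); apply/seteqP; split => w /=.
  move=> H; split; first by have := H ord0; rewrite unlift_none.
  by move=> i; have := H (lift ord0 i); rewrite liftK.
move=> [H0 H] i; by case: unliftP => [j ->|->].
Qed.

(** * Sub-intensity matrices of decreasing maps *)

Section decreasing_map.
Context (R : realType) (p : nat) (f : 'I_p -> option 'I_p) (lam : R).
Hypothesis lam0 : 0 < lam.
Hypothesis fdec : forall j k, f j = Some k -> (k < j)%N.

Lemma iter_obind_decreasing n j k :
  iter n (obind f) (Some j) = Some k -> (k + n <= j)%N.
Proof.
elim: n k => [|n IH] k /=; first by move=> [->]; rewrite addn0.
case E : (iter n (obind f) (Some j)) => [l|]//= flk.
by rewrite addnS (leq_trans _ (IH _ E))// ltn_add2r fdec.
Qed.

Lemma iter_obind_None s : iter p (obind f) s = None.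
Proof.
case: s => [j|]; last by rewrite iter_absorbed.
case E : (iter p (obind f) (Some j)) => [l|]//.
have := leq_trans (iter_obind_decreasing E) (ltnW (ltn_ord j)).
have := ltn_ord j => jp; have := iter_obind_decreasing E => lj.
by have := leq_ltn_trans (leq_trans (leq_addl l p) lj) jp; rewrite ltnn.
Qed.

Definition uniform_rates : 'M[R]_p :=
  \matrix_(j, k) (lam * ((f j == Some k)%:R - (j == k)%:R)).

Lemma sum_pred1 (s : option 'I_p) :
  \sum_k (s == Some k)%:R = (s != None)%:R :> R.
Proof.
case: s => [j|]; last by rewrite big1.
rewrite (bigD1 j)//= eqxx big1 ?addr0// => k kj.
by rewrite (_ : (Some j == Some k) = false)//; apply/negbTE; rewrite eq_sym.
Qed.

Lemma exit_uniform_rates j :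
  exit_rates uniform_rates j ord0 = lam * (f j == None)%:R.
Proof.
rewrite /exit_rates !mxE.
under eq_bigr do rewrite !mxE mulr1.
rewrite -mulr_sumr sumrB sum_pred1.
under eq_bigr do rewrite -[_ == _]/(Some j == Some _).
rewrite sum_pred1/=; case: (f j) => [k|] /=; ring.
Qed.

Lemma intensity_uniform_rates s u :
  intensity uniform_rates s u = lam * ((obind f s == u)%:R - (s == u)%:R).
Proof.
case: s u => [j|] [k|] //=; rewrite ?subrr ?mulr0//.
- by rewrite mxE.
- by rewrite exit_uniform_rates subr0.
Qed.

Lemma transient_uniform_rates : transient_sub_intensity uniform_rates.
Proof.
have fj j : (f j == Some j) = false.
  by apply/eqP => /fdec; rewrite ltnn.
split.
- by move=> j k jk; rewrite mxE (negbTE jk) subr0 mulr_ge0// ltW.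
- by move=> j; rewrite mxE fj eqxx sub0r mulrN1 oppr_lt0.
- move=> j; under eq_bigr do rewrite mxE.
  rewrite -mulr_sumr sumrB sum_pred1.
  under [X in _ - X]eq_bigr do rewrite -[_ == _]/(Some j == Some _).
  rewrite sum_pred1/= mulr_ge0_le0 ?(ltW lam0)// subr_le0.
  by case: (f j).
(* Since [f] lowers the index, the matrix is lower triangular, with [- lam] on the diagonal. *)
- rewrite unitmxE det_trig.
    rewrite unitfE; apply/prodf_neq0 => j _; rewrite mxE fj eqxx sub0r mulrN1.
    by rewrite oppr_eq0 gt_eqF.
  apply/is_trig_mxP => j k jk; rewrite mxE.
  have /negbTE -> : f j != Some k.
    by apply/eqP => /fdec; rewrite ltnNge (ltnW jk).
  have /negbTE -> : j != k by apply: contraTneq jk => ->; rewrite ltnn.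
  by rewrite subrr mulr0.
Qed.

End decreasing_map.

Section transition.
Context (R : realType) (S : finType) (f : S -> S) (z : S) (N : nat) (lam : R).
Hypothesis fN : forall s, iter N f s = z.
Hypothesis lam0 : 0 < lam.
Local Notation p := (poisson_trans f z N lam).

Lemma sum_poisson_trans t s : \sum_u p t s u = 1.
Proof.
rewrite /poisson_trans big_split/= exchange_big/= big1 ?add0r.
  rewrite (bigD1 z)//= eqxx big1 ?addr0// => u uz.
  by rewrite eq_sym (negbTE uz).
have H (v : S) : \sum_u (v == u)%:R = 1 :> R.
  rewrite (bigD1 v)//= eqxx big1 ?addr0// => u uz.
  by rewrite eq_sym (negbTE uz).
by move=> i _; rewrite -mulr_sumr sumrB !H subrr mulr0.
Qed.

(** Nonnegativity and the Chapman-Kolmogorov equation hold because [poisson_trans] is a law of clock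
    paths; the latter is total probability over the state at time [t]. The intensities come from the
    backward equation at 0. *)
Lemma poisson_transition_function :
  transition_function (fun s u => lam * ((f s == u)%:R - (s == u)%:R)) p.
Proof.
have [d [T [P [E [[sE pE mE] markovE]]]]] := markov_clocks N lam0.
have PE s L L0 := markovE S f z N fN s (fN s) L L0.
split.
- move=> t s u t0; rewrite -lee_fin -[p t s u]mulr1.
  rewrite -[_ * _]/(visit_prob p s [:: (t, u)]) -PE/= ?t0//.
- by move=> t s _; exact: sum_poisson_trans.
- by move=> s u; exact: poisson_trans_0.
- move=> t t' s u t0 t'0; apply: EFin_inj.
  rewrite -[p (t + t') s u]mulr1 -[p _ s u * 1]/(visit_prob p s [:: (t + t', u)]).
  rewrite -PE/= ?addr_ge0//.
  rewrite (@total_probability _ _ _ P S (fun w => clock_path f (E w) s t)).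
  + rewrite -sumEFin; apply: eq_bigr => v _.
    rewrite -[p _ v u]mulr1 -[_ * _]/(visit_prob p s [:: (t, v); (t', u)]).
    rewrite -PE/= ?t0 ?t'0//; congr (P _).
    by apply/seteqP; split => w /=; rewrite !add0r; [move=> [[-> _] ->]|move=> [-> [-> _]]].
  + by move=> v; exact: (@measurable_clock_path _ _ _ _ _ N E (cst t)).
  + by apply: (measurable_visits (K := N) f 0 s [:: (t + t', u)]).
- move=> s u.
  have := is_derive_poisson_trans lam fN 0 s u.
  rewrite !poisson_trans_0// => -[dv dE].
  rewrite -dE.
  have := dv; rewrite /derivable => /cvg_ex[l Hl].
  have -> : 'D_1 (fun x : R => p x s u) 0 = l by apply: cvg_lim Hl.
  have {}Hl := cvg_dnbhs_at_right Hl.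
  apply: cvg_trans Hl; apply: near_eq_cvg; apply: nearW => h /=.
  by rewrite poisson_trans_0// addr0 /GRing.scale/= mulr1 mulrC.
Qed.

End transition.

(** * Chains with independent clocks and a common initial state *)

Section construction.
Context (R : realType) (d : nat) (lam : R) (lam0 : 0 < lam).
Context (disp : measure_display) (Omega : measurableType disp).
Context (P : probability Omega R).
Context (p : nat) (J0 : Omega -> 'I_p).
Hypothesis mJ0 : forall j, measurable [set w | J0 w = j].
Context (f : 'I_d -> 'I_p -> option 'I_p).
Hypothesis fdec : forall i j k, f i j = Some k -> (k < j)%N.
Context (sh : 'I_d -> 'I_p -> nat).
Hypothesis sh_absorbed : forall i j, iter (sh i j) (obind (f i)) (Some j) = None.
Hypothesis sh_min : forall i j m, (m < sh i j)%N ->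
  iter m (obind (f i)) (Some j) != None.

Lemma shape_bounds i j : (0 < sh i j <= p)%N.
Proof.
apply/andP; split.
  by rewrite lt0n; apply/eqP => s0; have := sh_absorbed i j; rewrite s0.
rewrite leqNgt; apply/negP => /sh_min/eqP; apply.
exact: iter_obind_None (fdec (i := i)) _.
Qed.

Context (d1 : measure_display) (T1 : measurableType d1) (P1 : probability T1 R)
  (E : T1 -> seq R).
Hypothesis cE : clocks p E.
Hypothesis markovE : forall (S : finType) (f : S -> S) (z : S) (N : nat),
    (forall s, iter N f s = z) ->
    forall s, iter p f s = z -> forall L, all (fun hu => 0 <= hu.1) L ->
    P1 [set w | visits (clock_path f (E w) s) 0 L] =
    (visit_prob (poisson_trans f z N lam) s L)%:E.
Context (d2 : measure_display) (T2 : measurableType d2) (P2 : probability T2 R)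
  (X : 'I_d -> T2 -> T1).
Hypothesis mX : forall i, measurable_fun setT (X i).
Hypothesis XE : forall A : 'I_d -> set T1, (forall i, measurable (A i)) ->
    P2 [set w | forall i, A i (X i w)] = (\prod_(i < d) P1 (A i))%E.

Lemma measurable_coordinate i (A : set T1) : measurable A ->
  measurable [set w | A (X i w)].
Proof. by move=> mA; rewrite -[X in measurable X]setTI; exact: mX. Qed.

Lemma measurable_coordinates (A : 'I_d -> set T1) : (forall i, measurable (A i)) ->
  measurable [set w | forall i, A i (X i w)].
Proof.
move=> mA.
rewrite (_ : [set _ | _] = \bigcap_(i in [set: 'I_d]) [set w | A i (X i w)]).
  by apply: fin_bigcap_measurable => // i _; exact: measurable_coordinate.
by apply/seteqP; split => w /= H i; [move=> _; exact: H|exact: (H i)].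
Qed.

Lemma coordinate_law i (A : set T1) : measurable A ->
  P2 [set w | A (X i w)] = P1 A.
Proof.
move=> mA.
have mB i' : measurable (if i' == i then A else setT) by case: ifP.
have := XE mB; rewrite (bigD1 i)//= eqxx big1 ?mule1.
  move=> <-; congr (P2 _); apply/seteqP; split => w /=; last by move/(_ i); rewrite eqxx.
  by move=> Aw j; case: eqP => // ->.
by move=> j /negbTE ->; rewrite probability_setT.
Qed.

Local Notation PP := (P \x P2)%E.

Lemma slice_rectangle j (B : set T2) :
  [set w : Omega * T2 | J0 w.1 = j /\ B w.2] = [set w | J0 w = j] `*` B.
Proof. by []. Qed.

Lemma slice_law j (B : set T2) : measurable B ->
  PP [set w | J0 w.1 = j /\ B w.2] = (P [set w | J0 w = j] * P2 B)%E.
Proof. by move=> mB; rewrite slice_rectangle product_measure1E. Qed.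

Lemma measurable_mixture (B : 'I_p -> set T2) : (forall j, measurable (B j)) ->
  measurable [set w : Omega * T2 | B (J0 w.1) w.2].
Proof.
move=> mB.
rewrite (_ : [set _ | _] = \bigcup_(j in [set: 'I_p])
    [set w : Omega * T2 | J0 w.1 = j /\ B j w.2]).
  apply: fin_bigcup_measurable => // j _.
  by rewrite slice_rectangle; exact: measurableX.
apply/seteqP; split => w /=; first by exists (J0 w.1).
by move=> [j _ [->]].
Qed.

Lemma mixture_law (B : 'I_p -> set T2) : (forall j, measurable (B j)) ->
  PP [set w | B (J0 w.1) w.2] = (\sum_j P [set w | J0 w = j] * P2 (B j))%E.
Proof.
move=> mB; rewrite (@total_probability _ _ _ PP 'I_p (fun w => J0 w.1)); last 2 first.
- move=> j; rewrite (_ : [set _ | _] = [set w | J0 w = j] `*` [set: T2]).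
    exact: measurableX.
  by apply/seteqP; split => w //= [].
- exact: measurable_mixture.
apply: eq_bigr => j _; rewrite -slice_law//; congr (PP _).
by apply/seteqP; split => w /= [] H1 H2; split=> //; [rewrite -H2|rewrite H1].
Qed.

Definition jump i (t : R) (w : Omega * T2) : option 'I_p :=
  clock_path (obind (f i)) (E (X i w.2)) (Some (J0 w.1)) t.

Definition absorption i (w : Omega * T2) : R :=
  \sum_(e <- take (sh i (J0 w.1)) (E (X i w.2))) e.

Let fN i s : iter p (obind (f i)) s = None.
Proof. exact: iter_obind_None (fdec (i := i)) _. Qed.

Lemma measurable_jump i t s : measurable [set w | jump i t w = s].
Proof.
have [sE pE mE] := cE.
apply: (@measurable_mixture (fun j => [set w | clock_path (obind (f i)) (E (X i w)) (Some j) t = s])) => j.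
apply: (@measurable_coordinate i [set w | clock_path (obind (f i)) (E w) (Some j) t = s]).
exact: (@measurable_clock_path _ _ _ _ _ p E (cst t)).
Qed.

Lemma jump_schedule_law i n (t : nat -> R) (s : nat -> option 'I_p) :
  0 <= t 0%N -> (forall k, t k < t k.+1) ->
  PP [set w | forall k, (k < n)%N -> jump i (t k) w = s k] =
  (\sum_j P [set w | J0 w = j] *
    (visit_prob (poisson_trans (obind (f i)) None p lam) (Some j) (schedule n 0 t s))%:E)%E.
Proof.
have [sE pE mE] := cE.
move=> t0 tt.
pose B j := [set w | visits (clock_path (obind (f i)) (E w) (Some j)) 0 (schedule n 0 t s)].
have mB j : measurable (B j) by exact: (measurable_visits (K := p) (obind (f i)) 0 (Some j) (schedule n 0 t s) sE mE).
rewrite (_ : [set _ | _] = [set w : Omega * T2 | B (J0 w.1) (X i w.2)]).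
  rewrite (@mixture_law (fun j => [set w | B j (X i w)])).
    apply: eq_bigr => j _; rewrite coordinate_law//; congr (_ * _)%E.
    rewrite /B (markovE (fN i))//.
    exact: schedule_ge0.
  by move=> j; exact: measurable_coordinate.
apply/seteqP; split => w H; first exact/visits_schedule.
exact: (iffLR (visits_schedule _ _ _ _ _) H).
Qed.

(** For every initial state an additional observation contributes the same last factor, which
    therefore comes out of the sum over initial states. *)
Lemma jump_markov i :
  markov_jump_process PP (intensity (uniform_rates (f i) lam)) (jump i).
Proof.
split.
- by move=> t s _; exact: measurable_jump.
- by move=> w; exact: jump_path_clock_path.
exists (poisson_trans (obind (f i)) None p lam).
  rewrite (_ : intensity _ = fun s u => lam * ((obind (f i) s == u)%:R - (s == u)%:R)).
    exact: poisson_transition_function.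
  by apply/funext => s; apply/funext => u; rewrite intensity_uniform_rates.
move=> n t s t0 tt.
have L m : PP [set w | forall k, (k <= m)%N -> jump i (t k) w = s k] = _ :=
  jump_schedule_law i m.+1 s t0 tt.
refine (etrans (L n.+1) (esym (etrans (congr1 (fun x => x * _)%E (L n)) _))).
rewrite ge0_sume_distrl; last first.
  move=> j _; rewrite mule_ge0//.
  have [sE pE mE] := cE.
  rewrite -(markovE (fN i))//; exact: schedule_ge0.
by apply: eq_bigr => j _; rewrite -muleA -EFinM -visit_prob_schedule.
Qed.

Lemma absorption_gt0 i w : 0 < absorption i w.
Proof. exact: (sum_clocks_gt0 cE _ (shape_bounds i (J0 w.1))). Qed.

(** Clocks are positive for every outcome and [p] of them always suffice, so the infimum is
    attained, at a positive time. *)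
Lemma absorptionE i w : (absorption i w)%:E = absorption_time (jump i ^~ w).
Proof.
have [sE pE mE] := cE.
have abs t : 0 <= t -> jump i t w = None <-> absorption i w <= t.
  move=> t0; apply: clock_path_absorbed => //.
  - by rewrite sE; case/andP: (shape_bounds i (J0 w.1)).
  - by move=> m; exact: sh_min.
apply/eqP; rewrite eq_le; apply/andP; split.
  apply/ereal_infP => _ [t /= [t0 Jt] <-].
  by rewrite lee_fin -abs// ltW.
apply: ereal_inf_lbound; exists (absorption i w) => //=; split.
  exact: absorption_gt0.
by apply/abs => //; apply/ltW/absorption_gt0.
Qed.

(** Once the initial state is fixed, the chain is a function of its own clocks. The events with this
    property form a sigma-algebra containing the generators, so conditional independence reduces to
    independence of the clocks. *)
Lemma sigma_of_jump i (A : set (Omega * T2)) :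
  sigma_of_process (jump i) A ->
  forall j, exists B : set T1, measurable B /\
    forall w, J0 w.1 = j -> A w <-> B (X i w.2).
Proof.
have [sE pE mE] := cE.
suff H : sigma_of_process (jump i) `<=` [set A | forall j, exists B : set T1,
    measurable B /\ forall w : Omega * T2, J0 w.1 = j -> A w <-> B (X i w.2)].
  exact: H.
apply: smallest_sub.
  split => /=.
  - by move=> j; exists set0; split.
  - move=> C HC j; have [B [mB BC]] := HC j; exists (~` B); split.
      exact: measurableC.
    by move=> w wj; have := BC w wj => -[H1 H2]; split=> [[_ nC] /H2|nB]//; split=> // /H1.
  - move=> C HC j; have [B HB] := choice (fun n => HC n j).
    exists (\bigcup_n B n); split.
      by apply: bigcupT_measurable => n; have [] := HB n.
    move=> w wj; split=> -[n _]; have [_ /(_ w wj) H] := HB n.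
      by move=> /H Bn; exists n.
    by move=> /H Cn; exists n.
move=> _ [t [s [t0 ->]]] j.
exists [set w | clock_path (obind (f i)) (E w) (Some j) t = s]; split.
  exact: (@measurable_clock_path _ _ _ _ _ p E (cst t)).
by move=> w /= <-.
Qed.

Lemma jump_cond_independent :
  cond_independent PP (fun w => Some (J0 w.1)) jump.
Proof.
move=> [j|]; last first.
  move/eqP; rewrite (_ : [set _ | _] = set0) ?measure0//.
  by apply/seteqP; split.
move=> Pj A HA.
have JE : [set w : Omega * T2 | Some (J0 w.1) = Some j] = [set w | J0 w.1 = j /\ setT w.2].
  by apply/seteqP; split => w /=; [move=> [->]|move=> [->]].
have [B HB] := choice (fun i => sigma_of_jump (HA i) j).
have mB i : measurable (B i) by have [] := HB i.
have PJ : PP [set w : Omega * T2 | Some (J0 w.1) = Some j] = P [set w | J0 w = j].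
  by rewrite JE slice_law// probability_setT mule1.
have pj0 : fine (P [set w | J0 w = j]) != 0.
  by rewrite fine_eq0 ?fin_num_measure// -PJ.
have key (C : set T2) (D : set (Omega * T2)) : measurable C ->
    (forall w, J0 w.1 = j -> D w <-> C w.2) ->
    cond_prob PP D [set w | Some (J0 w.1) = Some j] = fine (P2 C).
  move=> mC DC.
  transitivity (fine (P [set w | J0 w = j] * P2 C)%E / fine (P [set w | J0 w = j])).
    congr (fine _ / fine _); last exact: PJ.
    rewrite -slice_law//; congr (PP _).
    apply/seteqP; split => w /=; first by move=> [Dw [wj]]; split=> //; apply/DC.
    by move=> [wj Cw]; split; [apply/DC|rewrite wj].
  rewrite fineM ?fin_num_measure//.
  by rewrite mulrC mulKf.
rewrite (key [set w | forall i, B i (X i w)]).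
- rewrite XE// (_ : (\prod_(i < d) P1 (B i))%E = (\prod_(i < d) fine (P1 (B i)))%:E)/=; last first.
    by rewrite (big_morph EFin (@EFinM R) erefl); apply: eq_bigr => i _; rewrite fineK// fin_num_measure.
  apply: eq_bigr => i _; rewrite (key [set w | B i (X i w)]) ?coordinate_law//.
    exact: measurable_coordinate.
  by have [] := HB i.
- exact: measurable_coordinates.
- move=> w wj; split => H i; have [_ /(_ w wj) [H1 H2]] := HB i; auto.
Qed.

Lemma measurable_absorption_time i j :
  measurable_fun setT (fun w => \sum_(e <- take (sh i j) (E (X i w))) e).
Proof.
exact: (measurableT_comp (measurable_sum_clocks cE (sh i j)) (mX i)).
Qed.

Definition absorption_tuple (w : Omega * T2) : d.-tuple R :=
  [tuple absorption i w | i < d].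

Definition started_tuple j (w : T2) : d.-tuple R :=
  [tuple \sum_(e <- take (sh i j) (E (X i w))) e | i < d].

Lemma measurable_started_tuple j : measurable_fun setT (started_tuple j).
Proof.
apply/measurable_fun_tnthP => i.
rewrite (_ : _ \o _ = fun w => \sum_(e <- take (sh i j) (E (X i w))) e).
  exact: measurable_absorption_time.
by apply/funext => w; rewrite /= tnth_mktuple.
Qed.

HB.instance Definition _ j :=
  isMeasurableFun.Build _ _ _ _ (started_tuple j) (measurable_started_tuple j).

Lemma measurable_absorption_tuple : measurable_fun setT absorption_tuple.
Proof.
move=> _ A mA; rewrite setTI.
apply: (@measurable_mixture (fun j => started_tuple j @^-1` A)) => j.
by rewrite -[X in measurable X]setTI; exact: measurable_started_tuple.
Qed.

HB.instance Definition _ :=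
  isMeasurableFun.Build _ _ _ _ absorption_tuple measurable_absorption_tuple.

Lemma started_tuple_erlang j :
  independent_erlang (sh ^~ j) (fun=> lam) (distribution P2 (started_tuple j)).
Proof.
split=> // [i|B mB]; first by case/andP: (shape_bounds i j).
pose A i := [set w | B i (\sum_(e <- take (sh i j) (E w)) e)].
have mA i : measurable (A i).
  by rewrite -[A i]setTI; exact: (measurable_sum_clocks cE).
transitivity (P2 [set w | forall i, A i (X i w)]).
  congr (P2 _); apply/seteqP; split => w /= H i; have := H i; by rewrite tnth_mktuple.
rewrite XE//; apply: eq_bigr => i _.
by rewrite /A (sum_clocks_erlang lam0 cE markovE)// shape_bounds.
Qed.

Lemma absorption_tuple_law (A : set (d.-tuple R)) : measurable A ->
  distribution PP absorption_tuple A =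
  (\sum_j P [set w | J0 w = j] * distribution P2 (started_tuple j) A)%E.
Proof.
move=> mA; apply: (@mixture_law (fun j => started_tuple j @^-1` A)) => j.
by rewrite -[X in measurable X]setTI; exact: measurable_started_tuple.
Qed.

Lemma sum_initial : \sum_j fine (P [set w | J0 w = j]) = 1.
Proof.
apply: EFin_inj; rewrite -sumEFin -(probability_setT P) [RHS](total_probability P mJ0)//.
by apply: eq_bigr => j _; rewrite setTI fineK// fin_num_measure.
Qed.

Lemma absorption_tuple_erlang_mixture :
  erlang_mixture (distribution PP absorption_tuple).
Proof.
exists p, (fun j => fine (P [set w | J0 w = j])), (fun j => sh ^~ j), (fun _ _ => lam),
  (fun j => distribution P2 (started_tuple j)); split.
- by move=> j; exact: fine_ge0.
- exact: sum_initial.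
- exact: started_tuple_erlang.
- move=> A mA; rewrite absorption_tuple_law//; apply: eq_bigr => j _.
  by rewrite fineK// fin_num_measure.
Qed.

Lemma absorption_tuple_mPH : mPH (distribution PP absorption_tuple).
Proof.
exists p, (\row_j fine (P [set w | J0 w = j])), (fun i => uniform_rates (f i) lam),
  _, (Omega * T2)%type, (P \x P2)%E, jump, absorption_tuple; split => //.
- split; first by move=> j; rewrite mxE fine_ge0.
  by under eq_bigr do rewrite mxE; exact: sum_initial.
- by move=> i; apply: transient_uniform_rates => //; exact: fdec.
- split; first exact: jump_markov.
  have [sE pE mE] := cE.
  exists (fun w => Some (J0 w.1)); split.
  + by move=> i w; rewrite /jump clock_path_0.
  + move=> j; rewrite mxE fineK ?fin_num_measure//.
    transitivity (PP [set w | J0 w.1 = j /\ setT w.2]).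
      by congr (PP _); apply/seteqP; split => w /=; [move=> [->]|move=> [->]].
    by rewrite slice_law// probability_setT mule1.
  + exact: jump_cond_independent.
- by apply: aeW => w i; rewrite tnth_mktuple absorptionE.
Qed.

(** The last clause retains the joint law of the initial state and the vector, which the deviation
    estimate needs and the law of [Y] alone forgets. *)
Lemma absorption_vector :
  exists (nu : 'I_p -> probability (d.-tuple R) R) (Y : {RV PP >-> d.-tuple R}),
  [/\ forall w i, 0 < tnth (Y w) i, mPH (distribution PP Y),
    erlang_mixture (distribution PP Y),
    forall j, independent_erlang (sh ^~ j) (fun=> lam) (nu j) &
    forall j A, measurable A ->
      PP [set w | J0 w.1 = j /\ A (Y w)] = (P [set w | J0 w = j] * nu j A)%E].
Proof.
exists (fun j => distribution P2 (started_tuple j)), absorption_tuple; split.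
- by move=> w i; rewrite tnth_mktuple absorption_gt0.
- exact: absorption_tuple_mPH.
- exact: absorption_tuple_erlang_mixture.
- exact: started_tuple_erlang.
move=> j A mA; rewrite -slice_law; last first.
  by rewrite -[X in measurable X]setTI; exact: measurable_started_tuple.
by congr (PP _); apply/seteqP; split => w /= [<-].
Qed.

End construction.

(** * Approximation on a grid *)

Section remaining_jumps.
Context (p : nat) (f : 'I_p -> option 'I_p) (r : 'I_p -> nat).
Hypothesis r0 : forall j, (0 < r j)%N.
Hypothesis fr : forall j,
  if f j is Some k then r k = (r j).-1 else r j = 1%N.

Lemma iter_obind_remaining m j :
  (iter m (obind f) (Some j) == None) = (r j <= m)%N.
Proof.
elim: m j => [|m IH] j; first by rewrite leqNgt r0.
rewrite iterSr /=; have := fr j; case: (f j) => [k|] rk.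
  by rewrite IH rk -(prednK (r0 j)) ltnS.
by rewrite iter_absorbed// rk ltnS.
Qed.

End remaining_jumps.

(** * Countdowns with prescribed numbers of jumps *)

Section chain.
Context (K M : nat) (k : 'I_M -> nat).
Hypothesis k0 : forall m, (0 < k m)%N.
Hypothesis kK : forall m, (k m <= K.+1)%N.

(* States below [K.+1] form a chain common to all the initial states, run
   downwards; state [K.+1 + m] is the initial state asking for [k m] jumps. *)
Definition remaining (j : 'I_(K.+1 + M)) : nat :=
  match fintype.split j with inl c => c.+1 | inr m => k m end.

(** State [c] of the common chain has [c + 1] jumps left, so the state with one jump fewer than [j]
    has index [(remaining j).-2]. *)
Definition chain_step (j : 'I_(K.+1 + M)) : option 'I_(K.+1 + M) :=
  if (1 < remaining j)%N then Some (lshift M (inord (remaining j).-2)) else None.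

Lemma remaining_gt0 j : (0 < remaining j)%N.
Proof. by rewrite /remaining; case: fintype.split. Qed.

Lemma remaining_le j : (remaining j <= K.+1)%N.
Proof. by rewrite /remaining; case: fintype.split. Qed.

Lemma remaining_rshift m : remaining (rshift K.+1 m) = k m.
Proof. by rewrite /remaining (unsplitK (inr m)). Qed.

Lemma chain_stepP j :
  if chain_step j is Some l then remaining l = (remaining j).-1
  else remaining j = 1%N.
Proof.
rewrite /chain_step; case: ifPn => [j1|].
  rewrite {1}/remaining (unsplitK (inl _)) inordK.
    by case: (remaining j) j1 => [|[|n]].
  rewrite (leq_trans _ (remaining_le j))//.
  by case: (remaining j) j1 => [|[|n]].
by rewrite -leqNgt => j1; apply/eqP; rewrite eqn_leq j1 remaining_gt0.
Qed.

Lemma chain_step_decreasing j l : chain_step j = Some l -> (l < j)%N.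
Proof.
rewrite /chain_step; case: ifP => // j1 [<-] /=.
have rK : ((remaining j).-2 < K.+1)%N.
  rewrite (leq_trans _ (remaining_le j))//.
  by case: (remaining j) j1 => [|[|n]].
rewrite inordK//; move: j1 rK; rewrite /remaining.
case: fintype.splitP => [c -> /=|m -> _ H]; first by case: c => -[].
by rewrite (leq_trans H)// leq_addr.
Qed.

End chain.

Lemma phase_type_approximation (R : realType) (d : nat) (lam : R)
    (disp : measure_display) (Omega : measurableType disp)
    (P : probability Omega R) (p : nat) (J0 : Omega -> 'I_p)
    (f : 'I_d -> 'I_p -> option 'I_p) (r : 'I_d -> 'I_p -> nat) :
  0 < lam -> (forall j, measurable [set w | J0 w = j]) ->
  (forall i j k, f i j = Some k -> (k < j)%N) ->
  (forall i j, (0 < r i j)%N) ->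
  (forall i j, if f i j is Some k then r i k = (r i j).-1 else r i j = 1%N) ->
  exists (d2 : measure_display) (T2 : measurableType d2) (P2 : probability T2 R)
    (nu : 'I_p -> probability (d.-tuple R) R)
    (Y : {RV (P \x P2)%E >-> d.-tuple R}),
  [/\ forall w i, 0 < tnth (Y w) i, mPH (distribution (P \x P2)%E Y),
    erlang_mixture (distribution (P \x P2)%E Y),
    forall j, independent_erlang (r ^~ j) (fun=> lam) (nu j) &
    forall j A, measurable A ->
      (P \x P2)%E [set w | J0 w.1 = j /\ A (Y w)] =
      (P [set w | J0 w = j] * nu j A)%E].
Proof.
move=> lam0 mJ0 fdec r0 fr.
have [d1 [T1 [P1 [E [cE markovE]]]]] := markov_clocks p lam0.
have [d2 [T2 [P2 [X [mX XE]]]]] := power_space P1 d.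
have sh_absorbed i j : iter (r i j) (obind (f i)) (Some j) = None.
  by apply/eqP; rewrite (iter_obind_remaining (r0 i) (fr i)).
have sh_min i j m : (m < r i j)%N -> iter m (obind (f i)) (Some j) != None.
  by rewrite (iter_obind_remaining (r0 i) (fr i)) -ltnNge.
exists d2, T2, P2.
exact: (@absorption_vector _ _ _ lam0 _ _ P p J0 mJ0 f fdec r sh_absorbed sh_min
  _ _ P1 E cE markovE _ _ P2 X mX XE).
Qed.

Section erlang_deviation.
Context (R : realType) (d : nat) (k : 'I_d -> nat) (lam : R).
Context (nu : probability (d.-tuple R) R).
Hypothesis lam0 : 0 < lam.
Hypothesis nuE : independent_erlang k (fun=> lam) nu.

Lemma measurable_deviation (i : 'I_d) (c eps : R) :
  measurable [set y : d.-tuple R | eps < `|tnth y i - c|].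
Proof.
rewrite -[X in measurable X]setTI.
have mf : measurable_fun setT (fun y : d.-tuple R => `|tnth y i - c|).
  by apply: measurableT_comp => //; apply: measurable_funB => //; exact: measurable_tnth.
have := @measurable_fun_ltr _ _ _ _ (cst eps) _ (measurable_cst _) mf.
by move/(_ measurableT [set true]); apply.
Qed.

Lemma independent_erlang_deviation (i : 'I_d) (eps : R) : 0 < eps ->
  (nu [set y : d.-tuple R | (eps < `|tnth y i - (k i)%:R / lam|)%R] <=
   ((k i)%:R / lam ^+ 2 / eps ^+ 2)%:E)%E.
Proof.
move=> e0; have [k0 _ nuB] := nuE.
pose A : set R := [set x | (eps < `|x - (k i)%:R / lam|)%R].
have mA : measurable A.
  rewrite -[X in measurable X]setTI.
  have mf : measurable_fun setT (fun x : R => `|x - (k i)%:R / lam|).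
    by apply: measurableT_comp => //; exact: measurable_funB.
  have := @measurable_fun_ltr _ _ _ _ (cst eps) _ (measurable_cst _) mf.
  by move/(_ measurableT [set true]); apply.
apply: le_trans (erlang_chebyshev lam0 (k0 i) e0).
have mB i' : measurable (if i' == i then A else setT) by case: ifP.
have := nuB _ mB; rewrite (bigD1 i)//= eqxx big1 ?mule1.
  move=> <-; rewrite le_measure ?inE//; first exact: measurable_deviation.
    rewrite (_ : [set _ | _] = [set y : d.-tuple R | eps < `|tnth y i - (k i)%:R / lam|]).
      exact: measurable_deviation.
    apply/seteqP; split => y /=; first by move/(_ i); rewrite eqxx.
    by move=> Ay j; case: eqP => // ->.
  by move=> y /= Ay j; case: eqP => // ->.
by move=> j /negbTE ->; rewrite erlang_prob_setT.
Qed.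

End erlang_deviation.

Section grid.
Context (R : realType) (N : nat).
Hypothesis N0 : (0 < N)%N.

(** The last cell collects everything from [N] on. The cell stands for the value
    [(grid_index x).+1 / N], rounded up so as to be positive, as an Erlang mean must be. *)
Definition grid_index (x : R) : 'I_(N * N).+1 :=
  inord (minn (Num.truncn (N%:R * x)) (N * N)).

Lemma measurable_grid_index v : measurable [set x | grid_index x = v].
Proof.
have mle m : measurable [set x : R | (Num.truncn (N%:R * x)%R <= m)%N].
  rewrite (_ : [set _ | _] = [set x : R | N%:R * x < m.+1%:R]); last first.
    by apply/seteqP; split => x /=; rewrite truncn_le_nat.
  rewrite -[X in measurable X]setTI.
  have mf : measurable_fun setT (fun x : R => N%:R * x) by exact: measurable_funM.
  have := @measurable_fun_ltr _ _ _ _ _ (cst (m.+1%:R : R)) mf (measurable_cst _).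
  by move/(_ measurableT [set true]); apply.
have meq m : measurable [set x : R | Num.truncn (N%:R * x) = m].
  case: m => [|m].
    rewrite (_ : [set _ | _] = [set x : R | (Num.truncn (N%:R * x)%R <= 0)%N])//.
    by apply/seteqP; split => x /=; [move=> ->|rewrite leqn0 => /eqP].
  rewrite (_ : [set _ | _] = [set x : R | (Num.truncn (N%:R * x)%R <= m.+1)%N] `\`
      [set x : R | (Num.truncn (N%:R * x)%R <= m)%N]).
    exact: measurableD.
  apply/seteqP; split => x /=; first by move=> ->; rewrite ltnn.
  by move=> [H1 /negP]; rewrite -ltnNge => H2; apply/eqP; rewrite eqn_leq H1.
rewrite (_ : [set _ | _] = \bigcup_(m in [set m | inord (minn m (N * N)) = v])
    [set x : R | Num.truncn (N%:R * x) = m]).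
  by apply: bigcup_measurable => m _.
apply/seteqP; split => x /=; first by move=> xv; exists (Num.truncn (N%:R * x)).
by move=> [m /= mv xm]; rewrite /grid_index xm.
Qed.

Lemma grid_index_close x : 0 < x -> x < N%:R ->
  `|(grid_index x).+1%:R / N%:R - x| <= N%:R^-1.
Proof.
move=> x0 xN.
have NR : 0 < N%:R :> R by rewrite ltr0n.
have y0 : 0 <= N%:R * x by rewrite mulr_ge0// ltW.
have /andP[t1 t2] := truncn_itv y0.
have tN : (Num.truncn (N%:R * x) <= N * N)%N.
  by rewrite truncn_le_nat -addn1 natrD natrM ltr_wpDr// ltr_pM2l.
rewrite /grid_index inordK; last by rewrite ltnS geq_minr.
rewrite (minn_idPl tN) ger0_norm; last first.
  by rewrite subr_ge0 ler_pdivlMr// mulrC ltW.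
rewrite lerBlDr ler_pdivrMr// mulrDl mulVf ?gt_eqF//.
by rewrite -natr1 [x * _]mulrC; lra.
Qed.

End grid.

Lemma grid_approximation (R : realType) (d : nat) (disp : measure_display)
    (Omega : measurableType disp) (P : probability Omega R)
    (X : {RV P >-> d.-tuple R}) (hX : forall w i, 0 < tnth (X w) i) (N : nat) :
  (0 < N)%N ->
  exists (d2 : measure_display) (T2 : measurableType d2) (P2 : probability T2 R)
    (Y : {RV (P \x P2)%E >-> d.-tuple R}),
  [/\ forall w i, 0 < tnth (Y w) i, mPH (distribution (P \x P2)%E Y),
    erlang_mixture (distribution (P \x P2)%E Y) &
    forall i eps, 0 < eps -> N%:R^-1 <= eps ->
      ((P \x P2)%E [set w | (2 * eps < `|tnth (Y w) i - tnth (X w.1) i|)%R] <=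
      P [set w | (N%:R <= tnth (X w) i)%R] + (2 / (N%:R * eps ^+ 2))%:E)%E].
Proof.
move=> N0.
have NR : 0 < N%:R :> R by rewrite ltr0n.
pose G := {ffun 'I_d -> 'I_(N * N).+1}.
(* [K.+1] is the largest shape, that of the last cell. *)
pose K := ((N * N).+1 * N).-1.
have KE : K.+1 = ((N * N).+1 * N)%N by rewrite prednK// muln_gt0.
pose k i (m : 'I_#|G|) : nat := ((enum_val m : G) i).+1 * N.
have k0 i m : (0 < k i m)%N by rewrite muln_gt0.
have kK i m : (k i m <= K.+1)%N by rewrite KE leq_mul2r ltn_ord orbT.
pose p := (K.+1 + #|G|)%N.
pose cell w : G := [ffun i => grid_index N (tnth (X w) i)].
pose J0 w : 'I_p := rshift K.+1 (enum_rank (cell w)).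
pose r i : 'I_p -> nat := remaining (k i).
pose f i : 'I_p -> option 'I_p := chain_step (k i).
pose lam : R := N%:R ^+ 2.
have lam0 : 0 < lam by rewrite exprn_gt0.
have mX i : measurable_fun setT (fun w => tnth (X w) i).
  exact: (measurableT_comp (measurable_tnth i)).
have mcell g : measurable [set w | cell w = g].
  rewrite (_ : [set _ | _] = \bigcap_(i in [set: 'I_d])
      ((fun w => tnth (X w) i) @^-1` [set x | grid_index N x = g i])).
    apply: fin_bigcap_measurable => // i _.
    by rewrite -[X in measurable X]setTI; apply: mX => //; exact: measurable_grid_index.
  apply/seteqP; split => w /=; first by move=> <- i _; rewrite ffunE.
  by move=> H; apply/ffunP => i; rewrite ffunE; exact: H.
have mJ0 j : measurable [set w | J0 w = j].
  rewrite (_ : [set _ | _] = \bigcup_(g in [set g | rshift K.+1 (enum_rank g) = j])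
      [set w | cell w = g]).
    by apply: fin_bigcup_measurable => // g _; exact: mcell.
  apply/seteqP; split => w /=; first by move=> wj; exists (cell w).
  by move=> [g /= <- wg]; rewrite /J0 wg.
have [|||d2 [T2 [P2 [nu [Y [Y0 mphY mixY nuE YE]]]]]] :=
    @phase_type_approximation R d lam _ Omega P p J0 f r lam0 mJ0.
- by move=> i j l; exact: chain_step_decreasing.
- by move=> i j; exact: remaining_gt0.
- by move=> i j; exact: chain_stepP.
exists d2, T2, P2, Y; split=> // i eps e0 Ne.
pose c j : R := (r i j)%:R / lam.
have cE w : c (J0 w) = (grid_index N (tnth (X w) i)).+1%:R / N%:R.
  rewrite /c /r remaining_rshift /k enum_rankK ffunE natrM /lam.
  by field; rewrite gt_eqF.
pose D j := [set y : d.-tuple R | eps < `|tnth y i - c j|].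
have mD j : measurable (D j) by exact: measurable_deviation.
have mYD j : measurable (Y @^-1` D j).
  by rewrite -[X in measurable X]setTI; exact: measurable_funPT.
have mJ j : measurable [set w : Omega * T2 | J0 w.1 = j].
  rewrite (_ : [set _ | _] = [set w | J0 w = j] `*` setT); first exact: measurableX.
  by apply/seteqP; split => w //= [].
have mA2 : measurable [set w : Omega * T2 | D (J0 w.1) (Y w)].
  rewrite (_ : [set _ | _] = \bigcup_(j in [set: 'I_p])
      ([set w : Omega * T2 | J0 w.1 = j] `&` Y @^-1` D j)).
    by apply: fin_bigcup_measurable => // j _; exact: measurableI.
  apply/seteqP; split => w /=; first by move=> H; exists (J0 w.1).
  by move=> [j _ [<-]].
have mA1 : measurable [set w | N%:R <= tnth (X w) i].
  have := @measurable_fun_ler _ _ _ _ (cst N%:R) _ (measurable_cst _) (mX i).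
  by move/(_ measurableT [set true]); rewrite setTI; apply.
have mbad : measurable [set w : Omega * T2 | 2 * eps < `|tnth (Y w) i - tnth (X w.1) i|].
  have mf : measurable_fun setT (fun w : Omega * T2 => `|tnth (Y w) i - tnth (X w.1) i|).
    apply: measurableT_comp => //; apply: measurable_funB.
      exact: (measurableT_comp (measurable_tnth i)).
    exact: (measurableT_comp (mX i) (@measurable_fst _ _ _ _)).
  have := @measurable_fun_ltr _ _ _ _ (cst (2 * eps)) _ (measurable_cst _) mf.
  by move/(_ measurableT [set true]); rewrite setTI; apply.
(* Below [N] the Erlang mean is within [1/N <= eps] of [X], so a deviation beyond [2 * eps] forces
   the Erlang variable more than [eps] away from its mean. *)
apply: (@le_trans _ _ ((P \x P2)%E (([set w | N%:R <= tnth (X w) i] `*` setT) `|`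
    [set w : Omega * T2 | D (J0 w.1) (Y w)]))).
  rewrite le_measure ?inE//; first by apply: measurableU => //; exact: measurableX.
  move=> w /= wbad; have [NX|XN] := leP N%:R (tnth (X w.1) i); first by left.
  right; rewrite /D/= cE.
  have := grid_index_close N0 (hX w.1 i) XN.
  set g := _ / _; set x := tnth (X _) _; set y := tnth _ _ => gx.
  have := ler_distD g y x; rewrite /x /y /g in gx wbad * => H.
  by have := lt_le_trans wbad H; lra.
apply: le_trans (measureU2 _ _ _) _ => //; first exact: measurableX.
have A1E : (P \x P2)%E ([set w | N%:R <= tnth (X w) i] `*` setT) =
    P [set w | N%:R <= tnth (X w) i].
  rewrite product_measure1E//.
  exact: etrans (congr1 (fun x => (_ * x)%E) (probability_setT P2)) (mule1 _).
apply: leeD; first by rewrite [leLHS]A1E.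
rewrite [leLHS](@total_probability _ _ _ (P \x P2)%E 'I_p (fun w => J0 w.1) _ mJ mA2).
(* The variance is the shape, at most [(N ^ 2 + 1) * N <= 2 * N ^ 3], divided by
   [lam ^ 2 = N ^ 4]. *)
have nuD j : (nu j (D j) <= (2 / (N%:R * eps ^+ 2))%:E)%E.
  apply: le_trans (independent_erlang_deviation lam0 (nuE j) i e0) _.
  have -> : 2 / (N%:R * eps ^+ 2) = 2 / N%:R / eps ^+ 2 by field; rewrite !gt_eqF.
  rewrite lee_fin ler_wpM2r ?invr_ge0 ?sqr_ge0//.
  have rK : (r i j)%:R <= 2 * N%:R ^+ 3 :> R.
    rewrite -natrX -natrM ler_nat (leq_trans (remaining_le (kK i) j))// KE.
    rewrite mulSn addnC mul2n -addnn !expnS expn0 muln1 [X in (X + _)%N]mulnC.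
    by rewrite leq_add2l leq_pmulr// muln_gt0 N0.
  rewrite ler_pdivrMr ?exprn_gt0//.
  rewrite (_ : 2 / N%:R * lam ^+ 2 = 2 * N%:R ^+ 3)// /lam.
  by field; rewrite gt_eqF.
apply: (@le_trans _ _ (\sum_j P [set w | J0 w = j] * (2 / (N%:R * eps ^+ 2))%:E)%E).
  apply: lee_sum => j _.
  apply: (@le_trans _ _ (P [set w | J0 w = j] * nu j (D j))%E); last first.
    by rewrite lee_wpmul2l.
  rewrite -YE// le_measure ?inE//.
  - exact: measurableI.
  - rewrite (_ : [set _ | _] = [set w : Omega * T2 | J0 w.1 = j] `&` Y @^-1` D j)//.
    exact: measurableI.
  - by move=> w /= [Dw wj]; rewrite -[in D j]wj.
rewrite -ge0_sume_distrl//.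
rewrite (_ : (\sum_j P [set w | J0 w = j])%E = 1%E) ?mul1e//.
rewrite -(probability_setT P) (total_probability P mJ0)//.
by apply: eq_bigr => j _; rewrite setTI.
Qed.

(** * Convergence in distribution *)

Section convergence.
Context (R : realType) (d : nat).

Lemma measurable_orthant (x : 'rV[R]_d) :
  measurable [set y : d.-tuple R | forall i, tnth y i <= x ord0 i].
Proof.
rewrite (_ : [set _ | _] = \bigcap_(i in [set: 'I_d])
    ((fun y : d.-tuple R => tnth y i) @^-1` `]-oo, x ord0 i]%classic)).
  apply: fin_bigcap_measurable => // i _.
  by rewrite -[X in measurable X]setTI; exact: (measurable_tnth i).
by apply/seteqP; split => y /= H i; [move=> _|have := H i I]; rewrite /= in_itv/=.
Qed.

(** Where all coordinates of [Y] and [Z] are within [eps], [Y] below [x] forces [Z] below [x + eps];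
    the rest is a union bound. *)
Lemma joint_cdf_coupling d' (T : measurableType d') (Q : probability T R)
    (Y Z : T -> d.-tuple R) (x : 'rV[R]_d) (eps : R) :
  measurable_fun setT Y -> measurable_fun setT Z ->
  (Q [set w | forall i, (tnth (Y w) i <= x ord0 i)%R] <=
   Q [set w | forall i, (tnth (Z w) i <= (x + const_mx eps) ord0 i)%R] +
   \sum_i Q [set w | (eps < `|tnth (Y w) i - tnth (Z w) i|)%R])%E.
Proof.
move=> mY mZ.
have morthant (V : T -> d.-tuple R) (y : 'rV[R]_d) : measurable_fun setT V ->
    measurable [set w | forall i, tnth (V w) i <= y ord0 i].
  move=> mV; have := mV measurableT _ (measurable_orthant y).
  by rewrite setTI.
pose bad i := [set w | eps < `|tnth (Y w) i - tnth (Z w) i|].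
have mbad i : measurable (bad i).
  have mf : measurable_fun setT (fun w => `|tnth (Y w) i - tnth (Z w) i|).
    apply: measurableT_comp => //; apply: measurable_funB.
      exact: (measurableT_comp (measurable_tnth i)).
    exact: (measurableT_comp (measurable_tnth i)).
  have := @measurable_fun_ltr _ _ _ _ (cst eps) _ (measurable_cst _) mf.
  by move/(_ measurableT [set true]); rewrite setTI; apply.
have [mU leU] : measurable (\big[setU/set0]_i bad i) /\
    (Q (\big[setU/set0]_i bad i) <= \sum_i Q (bad i))%E.
  apply: (big_rec2 (fun (U : set T) (q : \bar R) => measurable U /\ (Q U <= q)%E)).
    by rewrite measure0.
  move=> i q U _ [mU leU]; split; first exact: measurableU.
  by apply: le_trans (measureU2 _ _ _) _ => //; exact: leeD2l.
apply: le_trans (leeD2l _ leU).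
apply: le_trans _ (measureU2 _ _ _) => //; last exact: morthant.
rewrite le_measure ?inE//; first exact: morthant.
  by apply: measurableU => //; exact: morthant.
move=> w /= Yx; have [[i bi]|nb] := pselect (exists i, bad i w).
  by right; rewrite -bigcup_seq; exists i => //=; rewrite mem_index_enum.
left => i; rewrite !mxE.
have : `|tnth (Y w) i - tnth (Z w) i| <= eps.
  by rewrite leNgt; apply/negP => bi; apply: nb; exists i.
by rewrite ler_norml => /andP[? ?]; have := Yx i; lra.
Qed.

(** The error may depend on [eps]: continuity of the limit at [x] fixes [eps] first, and only then
    does [n] grow. *)
Lemma cvg_in_distribution_squeeze (mu_ : nat -> probability (d.-tuple R) R)
    (mu : probability (d.-tuple R) R) (b : R -> nat -> R) :
  (forall eps, 0 < eps -> b eps @ \oo --> 0) ->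
  (forall eps, 0 < eps -> \forall n \near \oo, forall x,
    (joint_cdf (mu_ n) x <= joint_cdf mu (x + const_mx eps) + (b eps n)%:E)%E /\
    (joint_cdf mu (x - const_mx eps) <= joint_cdf (mu_ n) x + (b eps n)%:E)%E) ->
  cvg_in_distribution mu_ mu.
Proof.
move=> b0 H x cx.
have fin (nu : probability (d.-tuple R) R) y : joint_cdf nu y \is a fin_num.
  by apply: fin_num_measure; exact: measurable_orthant.
rewrite -(fineK (fin mu x)); apply/fine_cvgP; split; first by apply: nearW => n.
apply/cvgrPdist_le => eta eta0.
have cx' : (fine \o joint_cdf mu) y @[y --> x] --> fine (joint_cdf mu x).
  have : joint_cdf mu y @[y --> x] --> (fine (joint_cdf mu x))%:E.
    by rewrite fineK//; exact: cx.
  by move/fine_cvg.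
have e2 : 0 < eta / 2 by rewrite divr_gt0.
have /cvgrPdist_le/(_ _ e2) := cx'.
move=> /nbhs_ballP[delta /= delta0 Hdelta].
pose eps := delta / 2.
have eps0 : 0 < eps by rewrite divr_gt0.
have ball_p : ball x delta (x + const_mx eps).
  split=> // i j; rewrite !mxE /ball/= opprD addNKr normrN gtr0_norm// /eps.
  by rewrite ltr_pdivrMr// ltr_pMr// ltr1n.
have ball_m : ball x delta (x - const_mx eps).
  split=> // i j; rewrite !mxE /ball/= opprB addrC subrK gtr0_norm// /eps.
  by rewrite ltr_pdivrMr// ltr_pMr// ltr1n.
have Hp := Hdelta _ ball_p; have Hm := Hdelta _ ball_m.
have /cvgrPdist_le/(_ _ e2) Hb := b0 _ eps0.
near=> n.
have [H1 H2] : (joint_cdf (mu_ n) x <= joint_cdf mu (x + const_mx eps) + (b eps n)%:E)%E /\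
    (joint_cdf mu (x - const_mx eps) <= joint_cdf (mu_ n) x + (b eps n)%:E)%E.
  by move: x {cx cx' Hdelta ball_p ball_m Hp Hm}; near: n; exact: H.
have : `|0 - b eps n| <= eta / 2 by near: n.
move: Hp Hm H1 H2 => /=.
rewrite -(fineK (fin mu (x + _))) -(fineK (fin mu (x - _))) -(fineK (fin (mu_ n) x)).
rewrite -!EFinD !lee_fin /= !ler_norml => /andP[? ?] /andP[? ?] ? ? /andP[? ?].
by apply/andP; split; lra.
Unshelve. all: end_near. Qed.

End convergence.

(** Bundles a space, its probability and a vector into one type, so that [choice] can select them
    for all [n] at once. *)
Record extension (R : realType) (d : nat) (disp : measure_display)
    (Omega : measurableType disp) (P : probability Omega R) := Extension {
  ext_disp : measure_display;
  ext_type : measurableType ext_disp;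
  ext_prob : probability ext_type R;
  ext_vector : {RV (P \x ext_prob)%E >-> d.-tuple R} }.

Theorem theorem3p5 (R : realType) (d : nat) (hd : (0 < d)%N)
    (disp : measure_display) (Omega : measurableType disp)
    (P : probability Omega R) (X : {RV P >-> d.-tuple R})
    (hX : forall w i, 0 < tnth (X w) i) :
  exists (disp_ : nat -> measure_display)
    (Omega_ : forall n, measurableType (disp_ n))
    (P_ : forall n, probability (Omega_ n) R)
    (X_ : forall n, {RV (P_ n) >-> d.-tuple R}),
  [/\ forall n w i, 0 < tnth (X_ n w) i,
      forall n, mPH (distribution (P_ n) (X_ n)),
      forall n, erlang_mixture (distribution (P_ n) (X_ n)) &
      cvg_in_distribution (fun n => distribution (P_ n) (X_ n))
        (distribution P X)].
Proof.
pose good n (e : extension d P) :=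
  let: Extension _ T2 P2 Y := e in
  [/\ forall w i, 0 < tnth (Y w) i, mPH (distribution (P \x P2)%E Y),
    erlang_mixture (distribution (P \x P2)%E Y) &
    forall i eps, 0 < eps -> n.+1%:R^-1 <= eps ->
      ((P \x P2)%E [set w | (2 * eps < `|tnth (Y w) i - tnth (X w.1) i|)%R] <=
      P [set w | (n.+1%:R <= tnth (X w) i)%R] + (2 / (n.+1%:R * eps ^+ 2))%:E)%E].
have /choice[e He] : forall n, exists e : extension d P, good n e.
  move=> n.
  have [d2 [T2 [P2 [Y HY]]]] := grid_approximation hX (ltn0Sn n).
  by exists (Extension Y).
exists (fun n => _), (fun n => (Omega * ext_type (e n))%type),
  (fun n => (P \x ext_prob (e n))%E), (fun n => ext_vector (e n)).
have {}He n : [/\ forall w i, 0 < tnth (ext_vector (e n) w) i,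
    mPH (distribution (P \x ext_prob (e n))%E (ext_vector (e n))),
    erlang_mixture (distribution (P \x ext_prob (e n))%E (ext_vector (e n))) &
    forall i eps, 0 < eps -> n.+1%:R^-1 <= eps ->
      ((P \x ext_prob (e n))%E
        [set w | (2 * eps < `|tnth (ext_vector (e n) w) i - tnth (X w.1) i|)%R] <=
      P [set w | (n.+1%:R <= tnth (X w) i)%R] + (2 / (n.+1%:R * eps ^+ 2))%:E)%E].
  by have := He n; case: (e n).
split; [by move=> n; have [] := He n|by move=> n; have [] := He n|by move=> n; have [] := He n|].
have mX i : measurable_fun setT (fun w => tnth (X w) i).
  exact: (measurableT_comp (measurable_tnth i)).
have mA i n : measurable [set w | n.+1%:R <= tnth (X w) i].
  have := @measurable_fun_ler _ _ _ _ (cst n.+1%:R) _ (measurable_cst _) (mX i).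
  by move/(_ measurableT [set true]); rewrite setTI; apply.
pose tail i n : R := fine (P [set w | n.+1%:R <= tnth (X w) i]).
(* The coordinates are finite, so these events decrease to the empty set. *)
have tail0 i : tail i @ \oo --> 0.
  suff : (fun n => P [set w | n.+1%:R <= tnth (X w) i]) @ \oo --> 0%:E.
    by move=> /fine_cvgP[_].
  rewrite (_ : 0%:E = P (\bigcap_n [set w | n.+1%:R <= tnth (X w) i])); last first.
    rewrite (_ : \bigcap_n _ = set0) ?measure0//.
    apply/seteqP; split => // w /= /(_ (Num.truncn (tnth (X w) i)) I) /=.
    by rewrite leNgt truncnS_gt.
  apply: nonincreasing_cvg_mu => //.
  - by rewrite -ge0_fin_numE// fin_num_measure.
  - exact: bigcapT_measurable.
  - move=> m n mn; apply/subsetPset => w /=; apply: le_trans.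
    by rewrite ler_nat.
(* The grid estimate with [N = n + 1] at [eps / 2], which controls deviations beyond
   [2 * (eps / 2) = eps], summed over the coordinates. *)
pose b (eps : R) n := \sum_i (tail i n + 2 / (eps / 2) ^+ 2 * harmonic n).
apply: (@cvg_in_distribution_squeeze _ _ _ _ b).
  move=> eps eps0.
  have -> : 0 = \sum_(i < d) (0 + 2 / (eps / 2) ^+ 2 * 0) :> R.
    by rewrite big1// => i _; rewrite mulr0 addr0.
  apply: cvg_big => [|i _]; first exact: add_continuous.
  apply: cvgD; first exact: tail0.
  by apply: cvgMr; exact: cvg_harmonic.
move=> eps eps0.
have e2 : 0 < eps / 2 by rewrite divr_gt0.
have : \forall n \near \oo, n.+1%:R^-1 <= eps / 2.
  have /cvgrPdist_le/(_ _ e2) := @cvg_harmonic R.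
  apply: filterS => n; rewrite sub0r normrN /harmonic/= ger0_norm//.
apply: filterS => n ne x.
have [_ _ _ /(_ _ _ e2 ne) Hn] := He n.
set Q := (P \x _)%E in Hn *; set Y := ext_vector _ in Hn *.
have mY : measurable_fun setT Y by [].
have mZ : measurable_fun setT (fun w : Omega * ext_type (e n) => X w.1).
  by apply: (measurableT_comp _ (@measurable_fst _ _ _ _)).
have QX (y : 'rV[R]_d) : Q [set w | forall i, tnth (X w.1) i <= y ord0 i] =
    joint_cdf (distribution P X) y.
  have mB : measurable [set w | forall i, tnth (X w) i <= y ord0 i].
    by rewrite -[X in measurable X]setTI; exact: (measurable_funPT X measurableT _ (measurable_orthant y)).
  transitivity (Q ([set w | forall i, tnth (X w) i <= y ord0 i] `*` setT)).
    by congr (Q _); apply/seteqP; split => w //= [].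
  rewrite [LHS]product_measure1E//.
  exact: etrans (congr1 (fun x => (_ * x)%E) (probability_setT _)) (mule1 _).
have Hb : (\sum_i Q [set w | (eps < `|tnth (Y w) i - tnth (X w.1) i|)%R] <= (b eps n)%:E)%E.
  rewrite /b -sumEFin; apply: lee_sum => i _.
  have := Hn i; rewrite mulrC divfK ?pnatr_eq0// => /le_trans; apply.
  rewrite /tail EFinD fineK ?fin_num_measure// leeD2l// lee_fin.
  by rewrite /harmonic/= invfM mulrA mulrAC.
split.
  apply: le_trans (joint_cdf_coupling Q x eps mY mZ) _.
  by rewrite [X in (X + _ <= _)%E]QX; exact: leeD2l.
(* The lower bound is the same coupling with the two vectors exchanged, taken at [x - eps]. *)
rewrite -QX; apply: le_trans (joint_cdf_coupling Q _ eps mZ mY) _.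
rewrite subrK; apply: leeD2l.
by under eq_bigr do under eq_set do rewrite distrC.
Qed.
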